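(* Assume the index set is discrete: $\mathcal W=\mathcal W_1\times\cdots\times\mathcal W_d$ with each $\mathcal W_k$ a countable subset of $\mathcal B_k$. For each $k$ let $Q^{(k)}$ be a fixed probability distribution on $\mathcal W_1\times\cdots\times\mathcal W_k$ and let $\gamma_k>0$. Let $C=LMR\sqrt2$ and let $P^\star_{W|S}$ be a conditional distribution (with values in $\mathcal W$) attaining $$\min_{P_{W|S}}\Big\{\mathbb E[L_S(W)]+\frac{C}{\sqrt n}\sum_{k=1}^d\beta_k\gamma_k\,D\big(P_{W_1\dots W_k|S}\,\big\|\,Q^{(k)}\,\big|\,P_S\big)\Big\}.$$ Given $\mu$, let $\widehat w=(\widehat w_1,\dots,\widehat w_d)\in\mathcal W$ achieve the minimum of $L_\mu$ over $\mathcal W$. Then $$\mathrm{risk}(\mu,P^\star_{W|S})\le\inf_{w\in\mathcal W}L_\mu(w)+\frac{C}{\sqrt n}\sum_{k=1}^d\beta_k\Big(\gamma_k\log\frac{1}{Q^{(k)}(\widehat w_1,\dots,\widehat w_k)}+\frac1{4\gamma_k}\Big).$$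
   Context: Setting: $d\ge2$, positive integers $m,\delta_1,\dots,\delta_d$, $\delta_0=m$, $R>0$, $\mathcal X=\{x\in\mathbb R^m:|x|_2\le R\}$, $\mathcal Y$ a set, $\mathsf Z=\mathcal X\times\mathcal Y$. For $1\le j\le d$ fix $M_j\in\mathbb R^{\delta_j\times\delta_{j-1}}$ with spectral norm $\|M_j\|_2>0$ and $\alpha_j>0$, and let $\mathcal B_j=\{\mathbf W\in\mathbb R^{\delta_j\times\delta_{j-1}}:\|\mathbf W-M_j\|_2\le\alpha_j\|M_j\|_2\}$. $\phi$ is a $1$-Lipschitz (Euclidean norm) activation with $\phi(0)=0$, $\phi_o$ is the identity or soft-max, and for $w=(\mathbf W_1,\dots,\mathbf W_d)\in\mathcal B_1\times\cdots\times\mathcal B_d$, $h_w(x)=\phi_o(\mathbf W_d\,\phi(\mathbf W_{d-1}\cdots\phi(\mathbf W_1x)\cdots))$. $M=\prod_j\|M_j\|_2$, $\beta_k=\alpha_k\exp(\sum_{i<k}\alpha_i)$. The loss $\ell:(\mathcal B_1\times\cdots\times\mathcal B_d)\times\mathsf Z\to[0,\infty)$ satisfies $|\ell(w,z)-\ell(w',z)|\le L|h_w(x)-h_{w'}(x)|_2$ for some $L>0$, all $w,w'$ and $z=(x,y)$. $S=(Z_1,\dots,Z_n)$ is i.i.d. from $\mu$ on $\mathsf Z$, $P_S=\mu^{\otimes n}$; an algorithm is a conditional distribution $P_{W|S}$ of $W=(W_1,\dots,W_d)$ given $S$, and $P_{W_1\dots W_k|S}$ is the corresponding conditional law of the first $k$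 components. $L_\mu(w)=\mathbb E_{Z\sim\mu}\ell(w,Z)$, $L_S(w)=\frac1n\sum_i\ell(w,Z_i)$, $\mathrm{risk}(\mu,P_{W|S})=\mathbb E[L_\mu(W)]$ under the joint law $\mu^{\otimes n}P_{W|S}$. Conditional relative entropy: $D(P_{Y|X}\|Q|P_X)=\int D(P_{Y|X=x}\|Q)\,\mathrm dP_X(x)$, where $D$ is relative entropy (KL divergence, natural log). *)

(* Defs.v *)
From HB Require Import structures.
From mathcomp Require Import all_boot all_order all_algebra.
From mathcomp Require Import all_classical all_reals all_analysis.

Set Implicit Arguments.
Unset Strict Implicit.
Unset Printing Implicit Defensive.
Import Order.TTheory GRing.Theory Num.Theory.
Local Open Scope classical_set_scope.
Local Open Scope ring_scope.

Section Norms.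
Variable R : realType.

Definition norm2 n (v : 'cV[R]_n) : R := Num.sqrt (\sum_(i < n) v i ord0 ^+ 2).

Definition specnorm m n (A : 'M[R]_(m, n)) : R :=
  sup [set norm2 (A *m v) | v in [set v : 'cV[R]_n | norm2 v <= 1]].

Definition softmax n (v : 'cV[R]_n) : 'cV[R]_n :=
  \col_i (expR (v i ord0) / \sum_(j < n) expR (v j ord0)).

Definition outact (soft : bool) n (v : 'cV[R]_n) : 'cV[R]_n :=
  if soft then softmax v else v.
End Norms.

Section Network.
Variable R : realType.
Variable delta : nat -> nat.

(** type of the weight matrix of layer i+1 (0-based index i):
    delta_{i+1} x delta_i *)
Definition layerT (i : nat) := 'M[R]_(delta i.+1, delta i).

Definition prefT (k : nat) := {dffun forall i : 'I_k, layerT i}.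

(** total accessor: i-th (0-based) matrix of w, 0 if out of range *)
Definition wget k (w : prefT k) (i : nat) : layerT i :=
  match (i < k)%N as b return ((i < k)%N = b -> layerT i) with
  | true => fun h => w (Ordinal h)
  | false => fun _ => 0
  end erefl.

Variable phi : forall k, 'cV[R]_k -> 'cV[R]_k.

Fixpoint hidden k (w : prefT k) (x : 'cV[R]_(delta 0)) (j : nat) : 'cV[R]_(delta j) :=
  match j with
  | 0 => x
  | j'.+1 => phi (wget w j' *m hidden w x j')
  end.

Definition net (soft : bool) d (w : prefT d) (x : 'cV[R]_(delta 0)) :=
  outact soft (wget w d.-1 *m hidden w x d.-1).

Definition wprefix k d (hk : (k <= d)%N) (w : prefT d) : prefT k :=
  [ffun i : 'I_k => w (widen_ord hk i)].

Definition inPref k (A : forall i : nat, set (layerT i)) : set (prefT k) :=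
  [set w | forall i : 'I_k, A i (w i)].

Variables (Mj : forall i : nat, layerT i) (alpha : nat -> R).

Definition Bset (i : nat) : set (layerT i) :=
  [set W | specnorm (W - Mj i) <= alpha i * specnorm (Mj i)].

(** beta_{i+1} = alpha_{i+1} exp(sum_{j <= i} alpha_j) (0-based) *)
Definition beta (i : nat) : R := alpha i * expR (\sum_(j < i) alpha j).


Definition Mprod d : R := \prod_(i < d) specnorm (Mj i).
End Network.
Arguments Bset {R delta} Mj alpha i _.

Section Discrete.
Local Open Scope ereal_scope.
Variable R : realType.

Definition is_pmf (T : choiceType) (A : set T) (p : T -> R) : Prop :=
  [/\ forall t, (0 <= p t)%R, forall t, ~ A t -> p t = 0%R
    & \esum_(t in A) (p t)%:E = 1].

(** summand p(t) log(p(t)/q(t)), with 0 log(0/q) = 0 and p log(p/0) = +oo *)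
Definition kl_term (T : Type) (p q : T -> R) (t : T) : \bar R :=
  if p t == 0%R then 0 else if q t == 0%R then +oo
  else ((p t) * ln (p t / q t))%:E.

(** D(p||q) = sum_t p(t) log(p(t)/q(t)) (natural log) for pmfs p, q,
   the series summed as (sum of positive parts) - (sum of negative parts) *)
Definition KL (T : choiceType) (p q : T -> R) : \bar R :=
  \esum_(t in [set: T]) maxe (kl_term p q t) 0
  - \esum_(t in [set: T]) maxe (- kl_term p q t) 0.

Definition log_inv (x : R) : \bar R := if x == 0%R then +oo else (ln x^-1)%:E.
End Discrete.

Section Learning.
Local Open Scope ereal_scope.
Variable R : realType.
Variables (dO dZ : measure_display) (Omega : measurableType dO)
  (Z : measurableType dZ).

Definition iid_sample (P : probability Omega R) (mu : probability Z R) n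
    (Zs : 'I_n -> Omega -> Z) : Prop :=
  [/\ forall i, measurable_fun [set: Omega] (Zs i),
      forall i A, measurable A -> P (Zs i @^-1` A) = mu A
    & forall A : 'I_n -> set Z, (forall i, measurable (A i)) ->
        P (\bigcap_(i in [set: 'I_n]) (Zs i @^-1` A i))
        = \prod_(i < n) P (Zs i @^-1` A i)].

Definition sample n (Zs : 'I_n -> Omega -> Z) (om : Omega) : n.-tuple Z :=
  [tuple Zs i om | i < n].

Definition is_cond_dist n (T : choiceType) (A : set T) (K : n.-tuple Z -> T -> R) :=
  (forall s, is_pmf A (K s)) /\ (forall t, measurable_fun [set: n.-tuple Z] (K ^~ t)).

Variable T : choiceType.

Definition LS n (l : T -> Z -> R) (s : n.-tuple Z) (w : T) : R :=
  (n%:R^-1 * \sum_(i < n) l w (tnth s i))%R.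

Definition Lmu (mu : probability Z R) (l : T -> Z -> R) (w : T) : \bar R :=
  \int[mu]_z (l w z)%:E.

Variables (P : probability Omega R) (n : nat) (Zs : 'I_n -> Omega -> Z).

Definition exp_emp_risk (A : set T) (l : T -> Z -> R) (K : n.-tuple Z -> T -> R) :=
  \int[P]_om \esum_(w in A) (K (sample Zs om) w)%:E * (LS l (sample Zs om) w)%:E.

Definition risk (A : set T) (mu : probability Z R) (l : T -> Z -> R)
    (K : n.-tuple Z -> T -> R) :=
  \int[P]_om \esum_(w in A) (K (sample Zs om) w)%:E * Lmu mu l w.

Definition cond_KL (U : choiceType) (p : n.-tuple Z -> U -> R) (q : U -> R) :=
  \int[P]_om KL (p (sample Zs om)) q.
End Learning.

Definition marg (R : realType) (delta : nat -> nat) k d (hk : (k <= d)%N)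
    (A : set (prefT R delta d)) (p : prefT R delta d -> R) (v : prefT R delta k) : R :=
  fine (\esum_(w in [set w | A w /\ wprefix hk w = v]) (p w)%:E)%E.

(* Main.v *)
(* Write gen(w) for the difference L_mu(w) - L_S(w) and, for k <= d, let w^(k) be
   the network whose first k layers are those of w and whose other layers are the
   reference matrices M_j.  Then gen(w) - gen(w^(0)) is the telescoping sum of the
   differences gen(w^(k)) - gen(w^(k-1)), and E gen(w^(0)) = 0.  The k-th
   difference depends on the first k layers only, and the Lipschitz estimates of
   the network bound the corresponding difference of losses by L M R beta_k, so by
   Hoeffding's lemma it is sub-Gaussian.  The Donsker-Varadhan inequality applied
   with prior Q^(k), at the temperature that makes C beta_k gamma_k / sqrt n the
   coefficient of the relative entropy, bounds risk(P) by the regularized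
   objective at P plus the terms C beta_k / (4 gamma_k sqrt n).  Finally the
   objective at the minimizer is at most its value at the Dirac mass at what. *)
Require Import Defs.
From HB Require Import structures.
From mathcomp Require Import all_boot all_order all_algebra.
From mathcomp Require Import all_classical all_reals all_analysis.
From mathcomp Require Import measurable_realfun ring lra.
Import Order.TTheory GRing.Theory Num.Theory.
Import numFieldNormedType.Exports.
Local Open Scope classical_set_scope.
Local Open Scope ring_scope.

(** Filling in the layers of [w] from the input side serves two ends. The k-th difference is a
    function of the k-th prefix, so its posterior average involves only the prefix marginal, the law
    in the k-th relative entropy. And the layers after the changed one are exactly the M_j, which is
    why beta_k carries the exponential of the earlier alphas alone. The loss is unbounded, and risks
    and relative entropies may be infinite, so subtraction is the obstacle. In the chaining and
    change-of-measure steps, terms are moved across identities or shifted by constants until all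
    summands are nonnegative; sums and integrals then commute freely, and finite constants are
    cancelled last. One dichotomy remains: either L_mu is infinite at [what] and the bound is
    trivial, or finiteness spreads to all w in the balls. Constants: Hoeffding gives the exponent
    t^2 a^2 / (2n) with a = L M R beta_k = C beta_k / sqrt 2. Dividing by t = sqrt n / (C beta_k
    gamma_k) leaves C beta_k / (4 gamma_k sqrt n); the sqrt 2 in C turns 1/2 into 1/4. *)

Section EuclideanNorm.
Set Implicit Arguments.
Unset Strict Implicit.
Context {R : realType}.
Implicit Types n : nat.

(** * Euclidean and spectral norms; soft-max is nonexpansive *)

Lemma norm2_sqr n (v : 'cV[R]_n) : norm2 v ^+ 2 = \sum_(i < n) v i ord0 ^+ 2.
Proof. by rewrite sqr_sqrtr// sumr_ge0// => i _; exact: sqr_ge0. Qed.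

Lemma norm2_ge0 n (v : 'cV[R]_n) : 0 <= norm2 v.
Proof. exact: sqrtr_ge0. Qed.

Lemma norm2_0 n : norm2 (0 : 'cV[R]_n) = 0.
Proof.
by rewrite /norm2 big1 ?sqrtr0// => i _; rewrite mxE expr0n.
Qed.

Lemma norm2_eq0 n (v : 'cV[R]_n) : norm2 v = 0 -> v = 0.
Proof.
move=> v0; have := norm2_sqr v; rewrite v0 expr0n/= => /esym/eqP.
rewrite psumr_eq0; last by move=> i _; exact: sqr_ge0.
move=> /allP v0i; apply/matrixP => i j; rewrite mxE (ord1 j).
have := v0i i (mem_index_enum i).
by rewrite sqrf_eq0 => /eqP.
Qed.

Lemma cauchy_schwarz_sqr n (u v : 'I_n -> R) :
  (\sum_i u i * v i) ^+ 2 <= (\sum_i u i ^+ 2) * (\sum_i v i ^+ 2).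
Proof.
rewrite -subr_ge0 -(pmulr_rge0 _ (ltr0Sn R 1)).
(* Lagrange's identity, with every unordered pair counted twice. *)
suff -> : 2 * ((\sum_i u i ^+ 2) * (\sum_i v i ^+ 2) - (\sum_i u i * v i) ^+ 2)
    = \sum_i \sum_j (u i * v j - u j * v i) ^+ 2.
  by apply: sumr_ge0 => i _; apply: sumr_ge0 => j _; exact: sqr_ge0.
have E : \sum_i \sum_j (u i * v j - u j * v i) ^+ 2 =
  \sum_i \sum_j (u i ^+ 2 * v j ^+ 2) + \sum_i \sum_j (v i ^+ 2 * u j ^+ 2)
  - 2 * \sum_i \sum_j ((u i * v i) * (u j * v j)).
  rewrite mulr_sumr -big_split -sumrB/=; apply: eq_bigr => i _.
  rewrite mulr_sumr -big_split -sumrB/=; apply: eq_bigr => j _; ring.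
by rewrite E -!big_distrlr/= [X in _ = _ + X - _]mulrC expr2; ring.
Qed.

Lemma cauchy_schwarz n (u v : 'cV[R]_n) :
  \sum_i u i ord0 * v i ord0 <= norm2 u * norm2 v.
Proof.
rewrite (le_trans (ler_norm _))// -ler_sqr ?nnegrE ?mulr_ge0 ?norm2_ge0//.
by rewrite exprMn !norm2_sqr real_normK ?num_real// cauchy_schwarz_sqr.
Qed.

Lemma norm2D n (u v : 'cV[R]_n) : norm2 (u + v) <= norm2 u + norm2 v.
Proof.
rewrite -ler_sqr ?nnegrE ?addr_ge0 ?norm2_ge0// sqrrD !norm2_sqr.
have -> : \sum_i (u + v) i ord0 ^+ 2 = \sum_i u i ord0 ^+ 2
    + (\sum_i u i ord0 * v i ord0) *+ 2 + \sum_i v i ord0 ^+ 2.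
  rewrite -sumrMnl -!big_split/=; apply: eq_bigr => i _.
  by rewrite !mxE sqrrD.
by rewrite !lerD2r lerD2l lerMn2r cauchy_schwarz.
Qed.

Lemma norm2Z n (c : R) (v : 'cV[R]_n) : norm2 (c *: v) = `|c| * norm2 v.
Proof.
rewrite /norm2 -sqrtr_sqr -sqrtrM ?sqr_ge0// mulr_sumr.
by congr Num.sqrt; apply: eq_bigr => i _; rewrite mxE exprMn.
Qed.

(** The Frobenius norm is a bound, by Cauchy-Schwarz on each row. Without an upper bound the [sup]
    in [specnorm] would be a default value that says nothing about [A]. *)
Lemma specnorm_has_ubound m n (A : 'M[R]_(m, n)) :
  has_ubound [set norm2 (A *m v) | v in [set v : 'cV[R]_n | norm2 v <= 1]].
Proof.
exists (Num.sqrt (\sum_i \sum_j A i j ^+ 2)) => _ [v /= v1 <-].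
apply: ler_wsqrtr; apply: ler_sum => i _; rewrite mxE.
apply: (le_trans (cauchy_schwarz_sqr (A i) (fun j => v j ord0))).
rewrite -norm2_sqr ler_piMr//; first by apply: sumr_ge0 => j _; exact: sqr_ge0.
by rewrite expr_le1// norm2_ge0.
Qed.

Lemma specnorm_ge0 m n (A : 'M[R]_(m, n)) : 0 <= specnorm A.
Proof.
apply: ub_le_sup; first exact: specnorm_has_ubound.
by exists 0; rewrite /= ?norm2_0// mulmx0 norm2_0.
Qed.

Lemma norm2_mulmx_le m n (A : 'M[R]_(m, n)) (v : 'cV[R]_n) :
  norm2 (A *m v) <= specnorm A * norm2 v.
Proof.
have [/eqP/norm2_eq0 ->|v0] := boolP (norm2 v == 0).
  by rewrite mulmx0 !norm2_0 mulr0.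
have vgt0 : 0 < norm2 v by rewrite lt0r v0 norm2_ge0.
rewrite -ler_pdivrMr// mulrC -(ger0_norm (norm2_ge0 v)) -normfV -norm2Z.
rewrite scalemxAr; apply: ub_le_sup; first exact: specnorm_has_ubound.
exists ((norm2 v)^-1 *: v) => //=.
by rewrite norm2Z normfV (ger0_norm (norm2_ge0 v)) mulVf.
Qed.

Lemma specnorm0 m n : specnorm (0 : 'M[R]_(m, n)) = 0.
Proof.
rewrite /specnorm -(sup1 (0 : R)); congr sup; apply/seteqP; split=> [_ [v _ <-]|_ ->].
  by rewrite mul0mx norm2_0.
by exists 0; rewrite /= ?norm2_0// mulmx0 norm2_0.
Qed.

(* Monotonicity of the softmax: [<u - v, p - q> = sum (p - q)(ln p - ln q)] is
   at least [|p - q|^2], because [ln' >= 1] on (0, 1]. *)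
Lemma softmax_lipschitz n (u v : 'cV[R]_n) :
  norm2 (softmax u - softmax v) <= norm2 (u - v).
Proof.
set p := softmax u; set q := softmax v.
suff : norm2 (p - q) ^+ 2 <= norm2 (u - v) * norm2 (p - q).
  have [-> _|pq0] := eqVneq (norm2 (p - q)) 0; first exact: norm2_ge0.
  by rewrite expr2 ler_pM2r// lt0r pq0 norm2_ge0.
apply: le_trans (cauchy_schwarz _ _); rewrite norm2_sqr.
(* In dimension 0 the normalizing sum is empty, hence zero; [Spos] requires a coordinate. *)
case: n u v @p @q => [|n] u v p q; first by rewrite !big_ord0.
pose S (w : 'cV[R]_n.+1) := \sum_(j < n.+1) expR (w j ord0).
have Spos w : 0 < S w.
  by rewrite /S big_ord_recl ltr_pwDl ?expR_gt0// sumr_ge0// => i _; rewrite expR_ge0.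
have smE (w : 'cV[R]_n.+1) i : softmax w i ord0 = expR (w i ord0) / S w by rewrite mxE.
have sm_gt0 (w : 'cV[R]_n.+1) i : 0 < softmax w i ord0.
  by rewrite smE; exact: divr_gt0 (expR_gt0 _) (Spos _).
have sm_sum (w : 'cV[R]_n.+1) : \sum_i softmax w i ord0 = 1.
  by rewrite (eq_bigr _ (fun i _ => smE w i)) -mulr_suml divff// gt_eqF//; exact: Spos.
have sm_le1 (w : 'cV[R]_n.+1) i : softmax w i ord0 <= 1.
  rewrite -(sm_sum w) (bigD1 i)//= lerDl sumr_ge0// => j _; exact: ltW.
have ln_sm (w : 'cV[R]_n.+1) i : ln (softmax w i ord0) = w i ord0 - ln (S w).
  by rewrite smE ln_div ?posrE ?expR_gt0// expRK.
have mono (x y : R) : 0 < x -> x <= y -> y <= 1 -> y - x <= ln y - ln x.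
  move=> x0 xy y1; have y0 := lt_le_trans x0 xy.
  have : ln (1 + (x / y - 1)) <= x / y - 1.
    by apply: le_ln1Dx; rewrite ltrBrDl subrr divr_gt0.
  rewrite addrC subrK ln_div ?posrE// => h.
  have : y - x <= 1 - x / y.
    rewrite -[X in _ <= X](@mulfK _ y) ?gt_eqF// mulrBl mul1r divfK ?gt_eqF//.
    by rewrite ler_peMr ?subr_ge0// invf_ge1.
  lra.
(* The logarithm of [softmax w] is [w] minus the constant [ln (S w)]; the constants drop out because
   [p] and [q] both sum to 1. *)
have Ept : \sum_i (u - v) i ord0 * (p - q) i ord0 =
    \sum_i (ln (p i ord0) - ln (q i ord0)) * (p i ord0 - q i ord0).
  transitivity (\sum_i ((ln (p i ord0) - ln (q i ord0)) * (p i ord0 - q i ord0)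
     + (ln (S u) - ln (S v)) * (p i ord0 - q i ord0))).
    apply: eq_bigr => i _; rewrite [in RHS]/p [in RHS]/q !ln_sm !mxE -/(S u) -/(S v); ring.
  rewrite big_split/= -mulr_sumr [X in _ + _ * X]sumrB !sm_sum subrr mulr0.
  by rewrite addr0.
rewrite Ept; apply: ler_sum => i _; rewrite !mxE -/(p i ord0) -/(q i ord0).
have := sm_gt0 u i; have := sm_gt0 v i; have := sm_le1 u i; have := sm_le1 v i.
have -> : (\sum_(j < n.+1) expR (u j ord0)) = S u by [].
have -> : (\sum_(j < n.+1) expR (v j ord0)) = S v by [].
rewrite -!smE -/p -/q => q1 p1 q0 p0.
rewrite expr2; have [pq|/ltW pq] := leP (q i ord0) (p i ord0).
  by rewrite ler_wpM2r ?subr_ge0// mono.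
by rewrite -mulrNN -[leRHS]mulrNN !opprB ler_wpM2r ?subr_ge0// mono.
Qed.

Lemma outact_lipschitz soft n (u v : 'cV[R]_n) :
  norm2 (outact soft u - outact soft v) <= norm2 (u - v).
Proof. by case: soft => //=; exact: softmax_lipschitz. Qed.

End EuclideanNorm.

(** * Perturbation of one layer of the network *)

Section NetworkBound.
Set Implicit Arguments.
Unset Strict Implicit.
Context {R : realType} {delta : nat -> nat} {d : nat}.
Variables (Mj : forall i : nat, layerT R delta i) (alpha : nat -> R).
Variable phi : forall k, 'cV[R]_k -> 'cV[R]_k.
Arguments phi : clear implicits.

Lemma wgetE k (w : prefT R delta k) (i : nat) (ik : (i < k)%N) :
  wget w i = w (Ordinal ik).
Proof.
rewrite /wget; move: (erefl (i < k)%N).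
case: {2 3}(i < k)%N => [h|h]; first by rewrite (bool_irrelevance h ik).
by move: h; rewrite ik.
Qed.

(* Interpolates between the reference network ([j = 0]) and [w] ([j = d]); the
   telescoping sum of the chaining argument runs over [j]. *)
Definition mixw (j : nat) k (w : prefT R delta k) : prefT R delta d :=
  [ffun i : 'I_d => if (i < j)%N then wget w i else Mj i].

Lemma wget_mixw j k (w : prefT R delta k) i : (i < d)%N ->
  wget (mixw j w) i = if (i < j)%N then wget w i else Mj i.
Proof. by move=> id; rewrite wgetE ffunE. Qed.

Hypothesis alpha_gt0 : forall i, (i < d)%N -> 0 < alpha i.

Lemma Bset_center i : (i < d)%N -> Bset Mj alpha i (Mj i).
Proof.
move=> id; rewrite /Bset /= subrr specnorm0 mulr_ge0 ?specnorm_ge0//.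
exact/ltW/alpha_gt0.
Qed.

Lemma specnorm_Bset i (W : layerT R delta i) (v : 'cV[R]_(delta i)) :
  Bset Mj alpha i W ->
  norm2 (W *m v) <= (1 + alpha i) * specnorm (Mj i) * norm2 v.
Proof.
move=> BW; rewrite -[W in W *m _](subrK (Mj i)) mulmxDl.
rewrite (le_trans (norm2D _ _))// addrC mulrDl mul1r mulrDl lerD ?norm2_mulmx_le//.
by rewrite (le_trans (norm2_mulmx_le _ _))// ler_wpM2r ?norm2_ge0.
Qed.

Lemma mixw_Bset j k (w : prefT R delta k) : (j <= k)%N -> (k <= d)%N ->
  inPref (Bset Mj alpha) w -> inPref (Bset Mj alpha) (mixw j w).
Proof.
move=> jk kd Bw i; rewrite ffunE; case: ifPn => ij; last exact: Bset_center.
by rewrite (wgetE w (leq_trans ij jk)); exact: Bw (Ordinal _).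
Qed.

Hypothesis phi_lipschitz :
  forall k (u v : 'cV[R]_k), norm2 (phi k u - phi k v) <= norm2 (u - v).
Hypothesis phi0 : forall k, phi k 0 = 0.
Variables (Rx : R) (x : 'cV[R]_(delta 0)).
Hypothesis xRx : norm2 x <= Rx.

Let s i := specnorm (Mj i).
Let expa j := expR (\sum_(i < j) alpha i).

(** A layer in [Bset] stretches by at most [1 + alpha i] times the norm of [Mj i], and
    [1 + alpha i <= expR (alpha i)] collects these factors into [expa]. The hypothesis [phi0] turns
    the Lipschitz property into a norm bound. *)
Lemma norm2_hidden (w : prefT R delta d) j : (j <= d)%N ->
  inPref (Bset Mj alpha) w ->
  norm2 (hidden phi w x j) <= \prod_(i < j) s i * expa j * Rx.
Proof.
move=> + Bw; elim: j => [_|j IH jd].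
  by rewrite /= big_ord0 /expa big_ord0 expR0 !mul1r.
have -> : hidden phi w x j.+1 = phi _ (wget w j *m hidden phi w x j) - phi _ 0.
  by rewrite phi0 subr0.
rewrite (le_trans (phi_lipschitz _ _))// subr0.
have /(specnorm_Bset (hidden phi w x j)) : Bset Mj alpha j (wget w j).
  by rewrite (wgetE w jd); exact: Bw (Ordinal _).
move/le_trans; apply.
have -> : \prod_(i < j.+1) s i * expa j.+1 * Rx =
    expR (alpha j) * s j * (\prod_(i < j) s i * expa j * Rx).
  by rewrite /expa !big_ord_recr/= expRD; ring.
rewrite ler_pM ?norm2_ge0 ?IH 1?ltnW//.
  by rewrite mulr_ge0 ?specnorm_ge0// addr_ge0// ltW// alpha_gt0.
by rewrite ler_wpM2r ?specnorm_ge0// expR_ge1Dx.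
Qed.

(** Only layer [k] differs. Below it the hidden vectors agree; there the change of matrix
    contributes [alpha k * s k] times the bound of [norm2_hidden]; above it both networks use [Mj],
    so a layer costs a factor [s j] and no exponential. *)
Lemma net_mixw_le soft k (w : prefT R delta k.+1) : (k < d)%N ->
  inPref (Bset Mj alpha) w ->
  norm2 (net phi soft (mixw k.+1 w) x - net phi soft (mixw k w) x)
    <= Mprod Mj d * beta alpha k * Rx.
Proof.
move=> kd Bw; set w1 := mixw k.+1 w; set w0 := mixw k w.
have Bw1 : inPref (Bset Mj alpha) w1 by exact: mixw_Bset.
have w01 i : (i < k)%N -> wget w1 i = wget w0 i.
  move=> ik; have id := ltn_trans ik kd.
  by rewrite !wget_mixw// ik ltnW.
have hid01 j : (j <= k)%N -> hidden phi w1 x j = hidden phi w0 x j.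
  by elim: j => //= j IH jk; rewrite IH 1?ltnW// w01.
(* The bound is carried on pre-activations because the last layer has no [phi]: the case [j = d.-1]
   is the argument of [outact]. *)
have pre j : (k <= j)%N -> (j < d)%N ->
  norm2 (wget w1 j *m hidden phi w1 x j - wget w0 j *m hidden phi w0 x j)
    <= \prod_(i < j.+1) s i * beta alpha k * Rx.
  elim: j => [|j IH].
    rewrite leqn0 => /eqP k0 _; move: (k0) => _; subst k.
    rewrite -mulmxBl !wget_mixw//= big_ord1 /beta big_ord0 expR0 mulr1.
    rewrite (le_trans (norm2_mulmx_le _ _))//.
    rewrite ler_pM ?specnorm_ge0 ?norm2_ge0// mulrC.
    by rewrite (wgetE w (ltnSn 0)); exact: Bw (Ordinal _).
  rewrite leq_eqVlt => /predU1P[kj jd|kj jd].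
    rewrite -(hid01 j.+1) -?kj// -mulmxBl kj !wget_mixw// -?kj// ltnSn ltnn.
    rewrite (le_trans (norm2_mulmx_le _ _))//.
    have hb : norm2 (hidden phi w1 x k) <= \prod_(i < k) s i * expa k * Rx.
      by apply: norm2_hidden => //; exact: ltnW.
    have Bk : specnorm (wget w k - Mj k) <= alpha k * s k.
      by rewrite (wgetE w (ltnSn k)); exact: Bw (Ordinal _).
    apply: (le_trans (ler_pM (specnorm_ge0 _) (norm2_ge0 _) Bk hb)).
    rewrite big_ord_recr/= /beta -/(expa k) -/(s k).
    rewrite le_eqVlt; apply/orP; left; apply/eqP; ring.
  have kj' : (k <= j)%N by rewrite -ltnS.
  have n1 : (j.+1 < k.+1)%N = false by rewrite ltnNge kj.
  have n0 : (j.+1 < k)%N = false by rewrite ltnNge ltnW.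
  rewrite !wget_mixw// n1 n0.
  rewrite -mulmxBr (le_trans (norm2_mulmx_le _ _))//.
  have -> : \prod_(i < j.+2) s i * beta alpha k * Rx =
      s j.+1 * (\prod_(i < j.+1) s i * beta alpha k * Rx).
    by rewrite big_ord_recr/=; ring.
  rewrite ler_wpM2l ?specnorm_ge0// (le_trans (phi_lipschitz _ _))//.
  by rewrite IH// ltnW.
rewrite (le_trans (outact_lipschitz _ _ _))//.
case: d kd w1 w0 Bw1 w01 hid01 pre; rewrite // => d' kd w1 w0 _ _ _ pre.
by rewrite /Mprod; exact: pre.
Qed.

End NetworkBound.

(** * Sums over countable sets as series *)

Section CountableSums.
Set Implicit Arguments.
Unset Strict Implicit.
Local Open Scope ereal_scope.
Context {R : realType}.

(** The enumeration [e] does not depend on the summand [a], so one indexing serves a whole family of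
    sums, and measurability and monotone convergence carry over from series. [None] fills the
    integers that code no element of [A]. *)
Lemma countable_esum_series (T : choiceType) (A : set T) : countable A ->
  exists2 e : nat -> option T, (forall i t, e i = Some t -> A t) &
  forall a : T -> \bar R, (forall t, A t -> 0 <= a t) ->
    \esum_(t in A) a t = \sum_(i <oo) (if e i is Some t then a t else 0).
Proof.
move=> /countable_injP[f finj].
pose e i := if pselect (exists t, A t /\ f t = i) is left h
  then Some (projT1 (cid h)) else None.
have eA i t : e i = Some t -> A t /\ f t = i.
  by rewrite /e; case: pselect => // h [<-]; case: (cid h).
have ef t : A t -> e (f t) = Some t.
  move=> At; rewrite /e; case: pselect => [h|[]]; last by exists t.
  by congr Some; case: (cid h) => u /= [Au fu]; apply: finj; rewrite ?inE.
exists e => [i t /eA[]//|a a0].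
pose b i := if e i is Some t then a t else 0.
have b0 i : 0 <= b i by rewrite /b; case E : (e i) => [t|]//; case: (eA _ _ E) => /a0.
rewrite nneseries_esumT//.
transitivity (\esum_(i in f @` A) b i).
  rewrite (esum_image A f b)//; apply: eq_esum => t At.
  by rewrite /b ef.
rewrite esum_mkcond; apply: eq_esum => i _; case: ifPn => //.
rewrite notin_setE /b => nfA; case E : (e i) => [t|]//; exfalso; apply: nfA.
by have [At <-] := eA _ _ E; exists t.
Qed.

Lemma esumZl (T : choiceType) (A : set T) (c : R) (a : T -> \bar R) :
  countable A -> (0 <= c)%R -> (forall t, A t -> 0 <= a t) ->
  \esum_(t in A) (c%:E * a t) = c%:E * \esum_(t in A) a t.
Proof.
move=> cA c0 a0; have [e eA E] := countable_esum_series cA.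
rewrite !E// => [|t At]; last by rewrite mule_ge0 ?lee_fin// a0.
rewrite -nneseriesZl => [|i _]; last by case Ei : (e i) => [t|]//; apply/a0/eA/Ei.
by apply: eq_eseriesr => i _; case: (e i) => //; rewrite mule0.
Qed.

Lemma emeasurable_esum (T : choiceType) (A : set T) d (X : measurableType d)
    (F : T -> X -> \bar R) : countable A ->
  (forall t, A t -> measurable_fun [set: X] (F t)) ->
  (forall t, A t -> forall x, 0 <= F t x) ->
  measurable_fun [set: X] (fun x => \esum_(t in A) F t x).
Proof.
move=> cA mF F0; have [e eA E] := countable_esum_series cA.
pose b i x := if e i is Some t then F t x else 0.
rewrite (_ : (fun _ => _) = fun x => \sum_(i <oo | i \in xpredT) b i x).
  apply: ge0_emeasurable_sum => [i x _ _|i _]; rewrite /b.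
    by case Ei : (e i) => [t|]//; apply/F0/eA/Ei.
  by case Ei : (e i) => [t|]//; apply/mF/eA/Ei.
by apply/funext => x; rewrite E// => t At; exact: F0.
Qed.

Lemma integral_esum (T : choiceType) (A : set T) d (X : measurableType d)
    (mu : {measure set X -> \bar R}) (F : T -> X -> \bar R) : countable A ->
  (forall t, A t -> measurable_fun [set: X] (F t)) ->
  (forall t, A t -> forall x, 0 <= F t x) ->
  \int[mu]_x (\esum_(t in A) F t x) = \esum_(t in A) \int[mu]_x F t x.
Proof.
move=> cA mF F0; have [e eA E] := countable_esum_series cA.
pose b i x := if e i is Some t then F t x else 0.
transitivity (\int[mu]_x \sum_(i <oo) b i x).
  by apply: eq_integral => x _; rewrite E// => t At; exact: F0.
rewrite integral_nneseries//; last 2 first.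
- by move=> i; rewrite /b; case Ei : (e i) => [t|]//; apply/mF/eA/Ei.
- by move=> i x _; rewrite /b; case Ei : (e i) => [t|]//; apply/F0/eA/Ei.
rewrite E => [|t At]; last by apply: integral_ge0 => x _; exact: F0.
apply: eq_eseriesr => i _; rewrite /b; case: (e i) => //.
by rewrite integral0.
Qed.

Lemma esum_fiber (T U : choiceType) (A : set T) (B : set U) (h : T -> U)
    (a : T -> \bar R) : (forall t, A t -> B (h t)) -> (forall t, A t -> 0 <= a t) ->
  \esum_(u in B) \esum_(t in [set t | A t /\ h t = u]) a t = \esum_(t in A) a t.
Proof.
move=> AB a0; rewrite (@esum_esum R U T B _ (fun u t => a t)) => [|u t _ /= [At _]]; last exact: a0.
rewrite (reindex_esum A _ (fun t => (h t, t)))//; split => /=.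
- by move=> t At; split => //=; exact: AB.
- by move=> t t' _ _ [].
- by move=> [u t] /= [Bu [At <-]]; exists t.
Qed.

End CountableSums.

(** * Probability mass functions and relative entropy *)

Section DiscreteDistributions.
Set Implicit Arguments.
Unset Strict Implicit.
Local Open Scope ereal_scope.
Context {R : realType} {T : choiceType}.
Implicit Types (A : set T) (p q : T -> R).

Lemma pmf_countable_esumr A p (c : R) : countable A -> is_pmf A p -> (0 <= c)%R ->
  \esum_(t in A) (p t * c)%:E = c%:E.
Proof.
move=> cA [p0 _ p1] c0; under eq_esum do rewrite mulrC EFinM.
by rewrite esumZl ?p1 ?mule1// => t _; rewrite lee_fin.
Qed.

(** The law of [h] under [p]. The fibre sums are at most 1, hence finite, and the first conjunct
    records that they survive [fine]. *)
Lemma pmf_map (U : choiceType) A (B : set U) (h : T -> U) p :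
  (forall t, A t -> B (h t)) -> is_pmf A p ->
  (forall u, (fine (\esum_(t in [set t | A t /\ h t = u]) (p t)%:E))%:E =
     \esum_(t in [set t | A t /\ h t = u]) (p t)%:E) /\
  is_pmf B (fun u => fine (\esum_(t in [set t | A t /\ h t = u]) (p t)%:E)).
Proof.
move=> AB [p0 pA p1].
have p0' t : 0 <= (p t)%:E by rewrite lee_fin.
have fib0 u : 0 <= \esum_(t in [set t | A t /\ h t = u]) (p t)%:E by exact: esum_ge0.
have fibE u : (fine (\esum_(t in [set t | A t /\ h t = u]) (p t)%:E))%:E =
     \esum_(t in [set t | A t /\ h t = u]) (p t)%:E.
  rewrite fineK// ge0_fin_numE// (@le_lt_trans _ _ 1) ?ltry//.
  rewrite -p1 [leLHS]esum_mkcond [leRHS]esum_mkcond; apply: le_esum => t _.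
  case: ifPn => [|_]; last by case: ifP.
  by rewrite inE => -[At _]; rewrite ifT// inE.
split=> //; split=> [u|u nBu|].
- exact: fine_ge0.
- rewrite esum1// => t [At hu]; exfalso; apply: nBu; rewrite -hu; exact: AB.
- by under eq_esum do rewrite fibE; rewrite esum_fiber.
Qed.

Lemma esum_pmf_map (U : choiceType) A (B : set U) (h : T -> U) p (g : U -> R) :
  countable A ->
  (forall t, A t -> B (h t)) -> is_pmf A p -> (forall u, B u -> (0 <= g u)%R) ->
  \esum_(u in B) ((fine (\esum_(t in [set t | A t /\ h t = u]) (p t)%:E)) * g u)%:E
  = \esum_(t in A) (p t * g (h t))%:E.
Proof.
move=> cA AB pA g0; have [fibE _] := pmf_map AB pA; have [p0 _ _] := pA.
rewrite -(@esum_fiber R T U A B h) => // [|t At]; last first.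
  by rewrite lee_fin mulr_ge0// g0//; exact: AB.
apply: eq_esum => u Bu; rewrite mulrC EFinM fibE -esumZl ?g0//.
- by apply: eq_esum => t [_ <-]; rewrite mulrC.
- by apply: (sub_countable _ cA); apply: subset_card_le => t [].
- by move=> t _; rewrite lee_fin.
Qed.

(** For nonzero [p] and [q] this is [ln y <= y - 1] at [y = q * expR x / p], multiplied by [p]: the
    Fenchel-Young inequality behind Donsker-Varadhan. *)
Lemma kl_term_ge (p q x : R) : (0 <= p)%R -> (0 <= q)%R ->
  (p * x + p)%:E <= kl_term (fun=> p) (fun=> q) tt + (q * expR x)%:E.
Proof.
move=> p0 q0; rewrite /kl_term; have [->|pn0] := eqVneq p 0%R.
  by rewrite mul0r add0r add0e lee_fin mulr_ge0// expR_ge0.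
have [->|qn0] := eqVneq q 0%R; first by rewrite addye ?leey.
have {}p0 : (0 < p)%R by rewrite lt0r pn0.
have {}q0 : (0 < q)%R by rewrite lt0r qn0.
have y0 : (0 < q * expR x / p)%R by rewrite divr_gt0 ?mulr_gt0 ?expR_gt0.
rewrite -EFinD lee_fin.
have : (ln (1 + (q * expR x / p - 1)) <= q * expR x / p - 1)%R.
  by apply: le_ln1Dx; rewrite ltrBrDl subrr.
rewrite addrC subrK !ln_div ?posrE ?mulr_gt0 ?expR_gt0//.
rewrite lnM ?posrE ?expR_gt0// expRK => /(ler_wpM2l (ltW p0)).
have -> : (p * (q * expR x / p - 1) = q * expR x - p)%R by field.
lra.
Qed.

(* The correction [q t - p t] sums to 0 over probability distributions, so that
   [\esum kl_nneg] is the relative entropy without any difference of series. *)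
Definition kl_nneg p q (t : T) : \bar R := kl_term p q t + (q t - p t)%:E.

Lemma kl_nneg_young p q t (x : R) : (0 <= p t)%R -> (0 <= q t)%R ->
  (p t * x + q t)%:E <= kl_nneg p q t + (q t * expR x)%:E.
Proof.
move=> p0 q0; rewrite /kl_nneg.
have := kl_term_ge x p0 q0; rewrite -[kl_term _ _ tt]/(kl_term p q t).
move=> /(leeD2r (q t - p t)%:E); rewrite -EFinD addeAC => H.
by rewrite (le_trans _ H)// lee_fin; lra.
Qed.

Lemma kl_nneg_ge0 p q t : (0 <= p t)%R -> (0 <= q t)%R -> 0 <= kl_nneg p q t.
Proof.
move=> p0 q0; have := kl_nneg_young 0 p0 q0.
by rewrite mulr0 add0r expR0 mulr1 -[leLHS]add0e leeD2rE.
Qed.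

(** The negative parts in [KL] are dominated termwise by [q], so their sum [N] is at most 1 and can
    be cancelled. Before that, [klK] moves them to the other side, leaving sums of nonnegative terms
    only. *)
Lemma KL_nneg A p q : is_pmf A p -> is_pmf A q ->
  KL p q = \esum_(t in A) kl_nneg p q t.
Proof.
move=> [p0 pA p1] [q0 qA q1]; rewrite /KL.
have kl0 t : ~ A t -> kl_term p q t = 0 by move=> nAt; rewrite /kl_term pA ?eqxx.
have toA (f : T -> \bar R) : (forall t, ~ A t -> f t = 0) ->
    \esum_(t in [set: T]) f t = \esum_(t in A) f t.
  move=> f0; rewrite [RHS]esum_mkcond; apply: eq_esum => t _.
  by case: ifPn => //; rewrite notin_setE => /f0.
rewrite !toA; try by move=> t /kl0 ->; rewrite ?oppe0 maxxx.
set N := \esum_(t in A) maxe (- _) 0; set S := \esum_(t in A) maxe (kl_term _ _ _) 0.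
have nneg t : 0 <= maxe (- kl_term p q t) 0 by rewrite le_max lexx orbT.
have sneg t : 0 <= maxe (kl_term p q t) 0 by rewrite le_max lexx orbT.
have klK t : kl_nneg p q t + (maxe (- kl_term p q t) 0 + (p t)%:E) =
    maxe (kl_term p q t) 0 + (q t)%:E.
  rewrite /kl_nneg; case E : (kl_term p q t) => [r| |].
  - rewrite -EFinN -!EFin_max -!EFinD; congr EFin.
    have [r0|r0] := leP r 0%R.
      by rewrite (@max_l _ _ (- r)%R) ?oppr_ge0//; ring.
    by rewrite (@max_r _ _ (- r)%R) ?oppr_le0 1?ltW//; ring.
  - by rewrite (@max_r _ _ (- +oo)) ?leNye// (@max_l _ _ +oo) ?leey// add0e !addye.
  - by move: E; rewrite /kl_term; case: ifP => //; case: ifP.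
have nle t : maxe (- kl_term p q t) 0 <= (q t)%:E.
  rewrite ge_max lee_fin q0 andbT.
  have := kl_term_ge 0 (p0 t) (q0 t); rewrite -[kl_term _ _ tt]/(kl_term p q t).
  rewrite mulr0 add0r expR0 mulr1 => H.
  rewrite leeNl -EFinN; case E : (kl_term p q t) H => [r| |].
  - by rewrite -EFinD !lee_fin; have := p0 t; lra.
  - by move=> _; rewrite leey.
  - by rewrite addNye leeNy_eq.
have Nfin : N \is a fin_num.
  rewrite ge0_fin_numE; last exact: esum_ge0.
  by rewrite (@le_lt_trans _ _ 1) ?ltry// -q1; apply: le_esum => u _; exact: nle.
have : \esum_(t in A) kl_nneg p q t + (N + 1) = S + 1.
  rewrite -p1 -esumD; try by move=> t _; rewrite ?nneg ?lee_fin.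
  rewrite -esumD; last 2 first.
  - by move=> t _; exact: kl_nneg_ge0.
  - by move=> t _; rewrite adde_ge0 ?nneg ?lee_fin.
  under eq_esum do rewrite klK.
  by rewrite esumD ?q1 ?p1// => t _; rewrite lee_fin.
rewrite addeA => /(congr1 (fun z => z - 1)); rewrite !addeK// => <-.
by rewrite addeK.
Qed.

Lemma measurable_kl_nneg d (X : measurableType d) (p : X -> T -> R) q t :
  measurable_fun [set: X] (p ^~ t) ->
  measurable_fun [set: X] (fun x => kl_nneg (p x) q t).
Proof.
move=> mp; apply: emeasurable_funD; last first.
  by apply/measurable_EFinP; exact: measurable_funB.
rewrite /kl_term; apply: measurable_fun_ifT => //.
  exact: measurable_fun_eqr.
case: (q t == 0%R) => //.
apply/measurable_EFinP; apply: measurable_funM => //.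
apply: measurableT_comp => //.
exact: measurable_funM.
Qed.

End DiscreteDistributions.

(** * The Donsker-Varadhan inequality, integrated over the sample *)

Section DonskerVaradhan.
Set Implicit Arguments.
Unset Strict Implicit.
Local Open Scope ereal_scope.
Context {R : realType} {d : measure_display} {Omega : measurableType d}.
Variables (P : probability Omega R) (T : choiceType) (A : set T).
Variables (p : Omega -> T -> R) (q : T -> R).
Hypothesis cA : countable A.
Hypothesis pA : forall om, is_pmf A (p om).
Hypothesis mp : forall t, measurable_fun [set: Omega] (p ^~ t).
Hypothesis qA : is_pmf A q.

Lemma measurable_KL : measurable_fun [set: Omega] (fun om => KL (p om) q).
Proof.
under eq_fun do rewrite (KL_nneg (pA _) qA).
apply: emeasurable_esum => // [t _|t _ x]; first exact: measurable_kl_nneg.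
by apply: kl_nneg_ge0; [case: (pA x) | case: qA].
Qed.

Lemma KL_ge0 om : 0 <= KL (p om) q.
Proof.
rewrite (KL_nneg (pA _) qA) esum_ge0// => t _.
by apply: kl_nneg_ge0; [case: (pA om) | case: qA].
Qed.

(* Young's inequality is applied with the cumulant bound [B] already subtracted
   from the exponent, so that the logarithm of the partition function never
   appears and no form of Jensen's inequality is needed. *)
Lemma integral_le_KL (G : T -> Omega -> R) (c t B : R) :
  (forall v, A v -> measurable_fun [set: Omega] (G v)) ->
  (forall v, A v -> forall om, `|G v om| <= c)%R ->
  (0 < t)%R -> (0 <= B)%R -> (0 <= c)%R ->
  (forall v, A v -> \int[P]_om (expR (t * G v om))%:E <= (expR B)%:E) ->
  t%:E * (\int[P]_om (\esum_(v in A) (p om v * (G v om + c))%:E))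
    <= (\int[P]_om KL (p om) q) + (B + t * c)%:E.
Proof.
move=> mG Gc t0 B0 c0 mgf; have [q0 _ q1] := qA.
have p0 om v : (0 <= p om v)%R by case: (pA om).
have Gc0 v om : A v -> (0 <= G v om + c)%R.
  by move=> /Gc/(_ om); rewrite ler_norml => /andP[]; lra.
have pGc0 om v : A v -> 0 <= (p om v * (G v om + c))%:E.
  by move=> Av; rewrite lee_fin mulr_ge0// Gc0.
pose S om := \esum_(v in A) (p om v * (G v om + c))%:E.
pose V om := \esum_(v in A) (q v * expR (t * G v om - B))%:E.
have S0 om : 0 <= S om by apply: esum_ge0 => v /pGc0.
have V0 om : 0 <= V om.
  by apply: esum_ge0 => v _; rewrite lee_fin mulr_ge0 ?expR_ge0.
(* Young's inequality summed over [A]. The 1 is the mass of [q] and is later cancelled against the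
   integral of [V]. The shift [c] makes the summands nonnegative and returns as [t * c] because
   [p om] has mass 1. *)
have pw om : t%:E * S om + 1 <= KL (p om) q + V om + (B + t * c)%:E.
  rewrite (KL_nneg (pA om) qA) -q1 -esumZl ?(ltW t0)//; last by move=> v /pGc0.
  rewrite -(@pmf_countable_esumr _ _ A (p om) (B + t * c))//; last first.
    by rewrite addr_ge0// mulr_ge0// ltW.
  rewrite /V -!esumD//.
  - apply: le_esum => v Av.
    have := kl_nneg_young (t * G v om - B) (p0 om v) (q0 v).
    move=> /(leeD2r (p om v * (B + t * c))%:E); apply: le_trans.
    by rewrite -EFinM -!EFinD lee_fin; lra.
  - by move=> v _; rewrite adde_ge0 ?kl_nneg_ge0// lee_fin mulr_ge0 ?expR_ge0.
  - by move=> v _; rewrite lee_fin mulr_ge0// addr_ge0// mulr_ge0// ltW.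
  - by move=> v _; rewrite kl_nneg_ge0.
  - by move=> v _; rewrite lee_fin mulr_ge0 ?expR_ge0.
  - by move=> v Av; rewrite mule_ge0 ?lee_fin ?(ltW t0)// mulr_ge0// Gc0.
  - by move=> v _; rewrite lee_fin.
have mS : measurable_fun [set: Omega] S.
  apply: emeasurable_esum => // [v Av|v Av om]; last exact: pGc0.
  apply/measurable_EFinP; apply: measurable_funM => //.
  by apply: measurable_funD => //; exact: mG.
have mexp v : A v -> measurable_fun [set: Omega] (fun om => expR (t * G v om - B)).
  move=> Av; apply: measurableT_comp => //; apply: measurable_funB => //.
  by apply: measurable_funM => //; exact: mG.
have mV : measurable_fun [set: Omega] V.
  apply: emeasurable_esum => // [v Av|v Av om]; last first.
    by rewrite lee_fin mulr_ge0 ?expR_ge0.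
  by apply/measurable_EFinP; apply: measurable_funM => //; exact: mexp.
have mKL := measurable_KL.
(* Since [q] does not depend on [om], the expectation passes inside the sum and [mgf] applies to
   each fixed [v]. *)
have intV : \int[P]_om V om <= 1.
  rewrite integral_esum// => [|v Av|v Av om]; last 2 first.
  - by apply/measurable_EFinP; apply: measurable_funM => //; exact: mexp.
  - by rewrite lee_fin mulr_ge0 ?expR_ge0.
  rewrite -q1; apply: le_esum => v Av.
  have -> : \int[P]_om (q v * expR (t * G v om - B))%:E =
     (q v * expR (- B))%:E * \int[P]_om (expR (t * G v om))%:E.
    transitivity (\int[P]_om ((q v * expR (- B))%:E * (expR (t * G v om))%:E)).
      by apply: eq_integral => om _; rewrite -EFinM expRD; congr EFin; ring.
    rewrite ge0_integralZl_EFin//.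
    - apply/measurable_EFinP; apply: measurableT_comp => //.
      by apply: measurable_funM => //; exact: mG.
    - by rewrite mulr_ge0 ?expR_ge0.
  apply: (@le_trans _ _ ((q v * expR (- B))%:E * (expR B)%:E)).
    by apply: lee_wpmul2l; [rewrite lee_fin mulr_ge0 ?expR_ge0|exact: mgf].
  by rewrite -EFinM -mulrA -expRD addNr expR0 mulr1.
have : \int[P]_om (t%:E * S om + 1) <=
       \int[P]_om (KL (p om) q + V om + (B + t * c)%:E).
  apply: ge0_le_integral => //.
  - by move=> om _; rewrite adde_ge0// mule_ge0 ?S0// lee_fin ltW.
  - by apply: emeasurable_funD => //; exact: measurable_funeM.
  - by apply: emeasurable_funD => //; exact: emeasurable_funD.
rewrite ge0_integralD//; last 2 first.
- by move=> om _; rewrite mule_ge0 ?S0// lee_fin ltW.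
- exact: measurable_funeM.
rewrite ge0_integralZl_EFin ?(ltW t0)//.
rewrite ge0_integralD//; last 3 first.
- by move=> om _; rewrite adde_ge0 ?KL_ge0.
- exact: emeasurable_funD.
- by move=> om _; rewrite lee_fin addr_ge0// mulr_ge0// ltW.
rewrite ge0_integralD//; last by move=> om _; exact: KL_ge0.
have I1 (r : R) : \int[P]_om r%:E = r%:E.
  by rewrite integral_cst//= probability_setT mule1.
rewrite !I1 => H.
rewrite -(@leeD2rE _ 1)// (le_trans H)// addeAC.
by apply: leeD2l.
Qed.

End DonskerVaradhan.

(** * Hoeffding's lemma *)

Section HoeffdingLemma.
Set Implicit Arguments.
Unset Strict Implicit.
Context {R : realType}.

Lemma mvt_le (f df : R -> R) (k h : R) : 0 <= h ->
  (forall x : R, is_derive x 1 f (df x)) -> (forall x, 0 <= x -> df x <= k) ->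
  f h <= f 0 + k * h.
Proof.
rewrite le_eqVlt => /predU1P[<- _ _|h0 fdf dfk]; first by rewrite mulr0 addr0.
have [c] : exists2 c, c \in `]0, h[ & f h - f 0 = df c * (h - 0).
  apply: MVT => //.
  by apply: derivable_within_continuous => x _; exact: ex_derive.
rewrite in_itv/= => /andP[c0 _]; rewrite subr0 => E.
by rewrite -lerBlDl E ler_wpM2r ?(ltW h0)// dfk// ltW.
Qed.

(** The left side is the moment generating function at [h] of a centred Bernoulli variable. Its
    logarithm is [ln (D h) - p * h]; the derivative of [ln D] is the tilted mean [s], whose slope is
    at most 1/4. Two uses of [mvt_le] integrate this to [h ^+ 2 / 8]. *)
Lemma hoeffding_two_points (p h : R) : 0 <= p <= 1 -> 0 <= h ->
  p * expR (h * (1 - p)) + (1 - p) * expR (- (h * p)) <= expR (h ^+ 2 / 8).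
Proof.
move=> /andP[p0 p1] h0.
pose D (x : R) : R := 1 - p + p * expR x.
have D_gt0 (x : R) : 0 < D x.
  rewrite /D; have := expR_gt0 x; have [->|pn0] := eqVneq p 0; first by rewrite mul0r; lra.
  by move=> ex; rewrite ltr_wpDl ?subr_ge0// mulr_gt0// lt0r pn0.
have dD (x : R) : is_derive x 1 D (p * expR x).
  by rewrite /D; apply: is_derive_eq; rewrite /GRing.scale/=; ring.
pose s (x : R) : R := 1 - (1 - p) * (D x)^-1.
have ds (x : R) : is_derive x 1 s ((1 - p) * (p * expR x) / D x ^+ 2).
  have dV : is_derive x 1 (fun y => (D y)^-1) (- (D x) ^- 2 *: (p * expR x)).
    by apply: is_deriveV; rewrite gt_eqF.
  rewrite /s; apply: is_derive_eq; rewrite /GRing.scale/=; ring.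
have sE (x : R) : s x = p * expR x / D x.
  by rewrite /s /D; field; rewrite -/(D x) gt_eqF.
have sle (x : R) : 0 <= x -> s x <= p + 4^-1 * x.
  move=> x0; have -> : p = s 0 by rewrite sE /D expR0; field; lra.
  apply: (mvt_le x0 ds) => y _.
  (* The product of the two summands of [D y] is at most a quarter of the square of their sum. *)
  rewrite ler_pdivrMr ?exprn_gt0// -subr_ge0 /D.
  suff -> : 4^-1 * (1 - p + p * expR y) ^+ 2 - (1 - p) * (p * expR y)
    = 4^-1 * (1 - p - p * expR y) ^+ 2 by rewrite mulr_ge0 ?sqr_ge0.
  by field.
pose F (x : R) : R := ln (D x) - p * x - x ^+ 2 / 8.
have dF (x : R) : is_derive x 1 F (s x - p - 4^-1 * x).
  have dl : is_derive x 1 (@ln R \o D) ((D x)^-1 * (p * expR x)).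
    by apply: is_derive1_comp; exact: is_derive1_ln.
  rewrite /F; apply: is_derive_eq; rewrite sE /GRing.scale/=; field.
  by rewrite gt_eqF.
have := mvt_le (k := 0) h0 dF.
have -> : F 0 = 0.
  by rewrite /F /D expR0 mulr1 subrK ln1 mulr0 expr0n/= mul0r !subr0.
rewrite mul0r addr0 => /(_ _) H.
have {}H : F h <= 0 by apply: H => x /sle; lra.
have -> : p * expR (h * (1 - p)) + (1 - p) * expR (- (h * p)) = expR (ln (D h) - p * h).
  rewrite expRD lnK ?posrE// /D mulrDl addrC mulrBr mulr1 expRD.
  by rewrite [p * h]mulrC; ring.
by rewrite ler_expR; move: H; rewrite /F; lra.
Qed.

(** Both tangent-line bounds are taken at the barycentre [m], where the weighted slope terms
    cancel. *)
Lemma expR_convex (l u v : R) : 0 <= l <= 1 ->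
  expR (l * u + (1 - l) * v) <= l * expR u + (1 - l) * expR v.
Proof.
move=> /andP[l0 l1]; set m := l * u + (1 - l) * v.
have tangent w : expR m * (1 + (w - m)) <= expR w.
  have -> : expR w = expR m * expR (w - m) by rewrite -expRD subrKC.
  rewrite ler_wpM2l ?expR_ge0//.
  exact: expR_ge1Dx.
have := ler_wpM2l l0 (tangent u).
have : (1 - l) * (expR m * (1 + (v - m))) <= (1 - l) * expR v.
  by rewrite ler_wpM2l// subr_ge0.
have : l * (expR m * (1 + (u - m))) + (1 - l) * (expR m * (1 + (v - m))) = expR m.
  by rewrite /m; ring.
lra.
Qed.

Local Open Scope ereal_scope.

Lemma norm_integral_le d (Z : measurableType d) (mu : probability Z R)
    (f : Z -> R) (a fbar : R) : measurable_fun [set: Z] f ->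
  (forall z, `|f z| <= a)%R -> \int[mu]_z (f z)%:E = fbar%:E -> (`|fbar| <= a)%R.
Proof.
move=> mf fa If.
have I1 (r : R) : \int[mu]_z r%:E = r%:E.
  by rewrite integral_cst//= probability_setT mule1.
rewrite -lee_fin -abse_EFin -If (le_trans (le_abse_integral _ _ _))//.
  exact/measurable_EFinP.
rewrite -(I1 a); apply: ge0_le_integral => //.
  by apply/measurable_EFinP; exact: measurableT_comp.
by move=> z _; rewrite lee_fin.
Qed.

(** The weight [l z] writes [f z] as a mixture of the endpoints [-a] and [a], and convexity bounds
    the exponential by an affine function of [f z]. Integration replaces [l z] by its mean [p]: the
    two-point case with [h] equal to [t] times the range [2 * a]. *)
Lemma hoeffding_lemma d (Z : measurableType d) (mu : probability Z R)
    (f : Z -> R) (a fbar t : R) : measurable_fun [set: Z] f ->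
  (0 < a)%R -> (forall z, `|f z| <= a)%R -> (0 <= t)%R ->
  \int[mu]_z (f z)%:E = fbar%:E ->
  \int[mu]_z (expR (t * (fbar - f z)))%:E <= (expR (t ^+ 2 * a ^+ 2 / 2))%:E.
Proof.
move=> mf a0 fa t0 If.
have intf : mu.-integrable [set: Z] (EFin \o f).
  apply: (@le_integrable _ _ _ _ _ measurableT _ (cst a%:E)) => //.
  - exact/measurable_EFinP.
  - by move=> z _; rewrite /= lee_fin (le_trans (fa z))// ler_norm.
  - exact: finite_measure_integrable_cst.
have I1 (r : R) : \int[mu]_z r%:E = r%:E.
  by rewrite integral_cst//= probability_setT mule1.
have fbara := norm_integral_le mf fa If.
pose l z : R := ((a - f z) / (2 * a))%R.
have l01 z : (0 <= l z <= 1)%R.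
  move: (fa z); rewrite ler_norml => /andP[f1 f2].
  rewrite /l divr_ge0 ?subr_ge0 ?mulr_ge0 ?(ltW a0)//=.
  by rewrite ler_pdivrMr ?mulr_gt0//; lra.
pose p := ((a - fbar) / (2 * a))%R.
have p01 : (0 <= p <= 1)%R.
  move: fbara; rewrite ler_norml => /andP[f1 f2].
  rewrite /p divr_ge0 ?subr_ge0 ?mulr_ge0 ?(ltW a0)//=.
  by rewrite ler_pdivrMr ?mulr_gt0//; lra.
pose h := (2 * a * t)%R.
have h0 : (0 <= h)%R by rewrite !mulr_ge0// ltW.
have Ep : fbar = (a - 2 * a * p)%R by rewrite /p; field; rewrite gt_eqF.
pose u := (h * (1 - p))%R; pose v := (- (h * p))%R.
have two z : (expR (t * (fbar - f z)) <= l z * expR u + (1 - l z) * expR v)%R.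
  apply: le_trans (expR_convex _ _ (l01 z)); rewrite ler_expR le_eqVlt.
  by apply/orP; left; apply/eqP; rewrite /u /v /h Ep /l; field; rewrite gt_eqF.
have Eaff z : (l z * expR u + (1 - l z) * expR v =
    ((expR u + expR v) / 2) + ((expR v - expR u) / (2 * a)) * f z)%R.
  by rewrite /l; field; rewrite gt_eqF.
apply: (@le_trans _ _ (\int[mu]_z (l z * expR u + (1 - l z) * expR v)%:E)).
  apply: ge0_le_integral => //.
  - apply/measurable_EFinP; apply: measurableT_comp => //.
    by apply: measurable_funM => //; exact: measurable_funB.
  - under eq_fun do rewrite Eaff.
    apply/measurable_EFinP; apply: measurable_funD => //.
    exact: measurable_funM.
  - by move=> z _; rewrite lee_fin.
have -> : \int[mu]_z (l z * expR u + (1 - l z) * expR v)%:E =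
    (p * expR u + (1 - p) * expR v)%:E.
  set c1 := ((expR u + expR v) / 2)%R in Eaff.
  set c2 := ((expR v - expR u) / (2 * a))%R in Eaff.
  under eq_integral do rewrite Eaff EFinD (EFinM c2).
  rewrite integralD//; last 2 first.
  - exact: finite_measure_integrable_cst.
  - exact: (integrableZl measurableT c2 intf).
  rewrite I1 integralZl// If -EFinM -EFinD; congr EFin.
  by rewrite /c1 /c2 Ep; field; rewrite gt_eqF.
rewrite lee_fin (le_trans (hoeffding_two_points p01 h0))// ler_expR le_eqVlt.
by apply/orP; left; apply/eqP; rewrite /h; field.
Qed.

End HoeffdingLemma.

(** * Product expectations and exponential moments of an i.i.d. sample *)

Section IndependentSample.
Import HBNNSimple.
Set Implicit Arguments.
Unset Strict Implicit.
Local Open Scope ereal_scope.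
Context {R : realType} {dO dZ : measure_display}.
Context {Omega : measurableType dO} {Z : measurableType dZ}.
Variables (P : probability Omega R) (mu : probability Z R).

Lemma cvg_integral_nd d (T : measurableType d) (nu : {measure set T -> \bar R})
    (f_ : (T -> \bar R)^nat) (f : T -> \bar R) :
  (forall k, measurable_fun [set: T] (f_ k)) -> (forall k x, 0 <= f_ k x) ->
  (forall x, {homo f_ ^~ x : k m / (k <= m)%N >-> k <= m}) ->
  (forall x, f_ k x @[k --> \oo] --> f x) ->
  \int[nu]_x f_ k x @[k --> \oo] --> \int[nu]_x f x.
Proof.
move=> mf f0 fnd ff; rewrite (_ : \int[nu]_x f x = \int[nu]_x limn (f_ ^~ x)).
  by apply: cvg_monotone_convergence => // x _; exact: fnd.
by apply: eq_integral => x _; apply/esym/cvg_lim => //; exact: ff.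
Qed.

(** Extends a product rule from indicators to nonnegative [g] through increasing simple functions.
    In the main use [Y] is the product of the remaining factors and [c] its expectation. *)
Lemma integral_mul_comp (X : Omega -> Z) (Y : Omega -> R) (c : R) (g : Z -> R) :
  measurable_fun [set: Omega] X -> measurable_fun [set: Omega] Y ->
  (forall om, (0 <= Y om)%R) ->
  (forall A, measurable A -> \int[P]_om (Y om * \1_A (X om))%:E = c%:E * mu A) ->
  measurable_fun [set: Z] g -> (forall z, (0 <= g z)%R) ->
  \int[P]_om (Y om * g (X om))%:E = c%:E * \int[mu]_z (g z)%:E.
Proof.
move=> mX mY Y0 HA mg g0.
have mg' : measurable_fun [set: Z] (EFin \o g) by exact/measurable_EFinP.
pose s_ := nnsfun_approx measurableT mg'.
have s_cvg z : (s_ k z)%:E @[k --> \oo] --> (g z)%:E.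
  by apply: (cvg_nnsfun_approx measurableT mg') => // z' _; rewrite lee_fin.
have s_nd z : {homo (fun k => (s_ k z)%:E) : k m / (k <= m)%N >-> k <= m}.
  by move=> k m km; rewrite lee_fin; exact/lefP/nd_nnsfun_approx.
have lhs : \int[P]_om (Y om * s_ k (X om))%:E @[k --> \oo]
    --> \int[P]_om (Y om * g (X om))%:E.
  apply: cvg_integral_nd => [k|k om|om k m km|om].
  - apply/measurable_EFinP; apply: measurable_funM => //.
    by apply: measurableT_comp => //; exact: measurable_funP.
  - by rewrite lee_fin mulr_ge0.
  - by rewrite lee_fin ler_wpM2l// -lee_fin s_nd.
  - by under eq_fun do rewrite EFinM; rewrite EFinM; exact: cvgeZl.
have rhs : c%:E * \int[mu]_z (s_ k z)%:E @[k --> \oo]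
    --> c%:E * \int[mu]_z (g z)%:E.
  apply: cvgeZl => //; apply: cvg_integral_nd => [k|k z|z k m km|z] //.
  - by apply/measurable_EFinP; exact: measurable_funP.
  - by rewrite lee_fin.
  - exact: s_nd.
rewrite -(cvg_lim _ lhs)// -(cvg_lim _ rhs)//; congr (limn _); apply/funext => k.
move: (s_ k) => s; rewrite integralT_nnsfun sintegralE.
have sr r : measurable (s @^-1` [set r]) by exact: measurable_funPTI.
have mYs r : measurable_fun [set: Omega] (fun om => (Y om * \1_(s @^-1` [set r]) (X om))%:E).
  apply/measurable_EFinP; apply: measurable_funM => //.
  exact: measurableT_comp.
transitivity (\int[P]_om (\sum_(r \in range s)
    (r%:E * (Y om * \1_(s @^-1` [set r]) (X om))%:E))).
  apply: eq_integral => om _; rewrite [in LHS]fimfunE mulrC.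
  rewrite EFinM -fsumEFin// ge0_mule_fsuml => [|r]; last first.
    by rewrite EFinM nnfun_muleindic_ge0.
  by apply: eq_fsbigr => r _; rewrite !EFinM muleAC muleA.
rewrite ge0_integral_fsum//; last 2 first.
- by move=> r; exact: measurable_funeM.
- move=> r om _; rewrite EFinM muleCA mule_ge0 ?lee_fin//.
  exact: nnfun_muleindic_ge0.
rewrite ge0_mule_fsumr; last first.
  by move=> r; exact: nnsfun_mulemu_ge0.
apply: eq_fsbigr => r; rewrite inE => -[z _ <-].
rewrite ge0_integralZl_EFin//; last by move=> om _; rewrite lee_fin mulr_ge0.
by rewrite HA// muleCA.
Qed.

Context {n : nat}.
Variable Zs : 'I_n -> Omega -> Z.
Hypothesis iid : iid_sample P mu Zs.

(** The definition [iid_sample] states independence for sets only; indicators are exchanged for the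
    functions [h i] one index at a time. *)
Lemma integral_prod_iid (h : 'I_n -> Z -> R) (c : 'I_n -> R) :
  (forall i, measurable_fun [set: Z] (h i)) -> (forall i z, (0 <= h i z)%R) ->
  (forall i, \int[mu]_z (h i z)%:E = (c i)%:E) ->
  \int[P]_om (\prod_i h i (Zs i om))%:E = (\prod_i c i)%:E.
Proof.
move=> mh h0 hc; have [mZ Zmu Zind] := iid.
pose F k (A : 'I_n -> set Z) (i : 'I_n) z : R := if (i < k)%N then h i z else \1_(A i) z.
pose e k (A : 'I_n -> set Z) (i : 'I_n) : R := if (i < k)%N then c i else fine (mu (A i)).
have F0 k A i z : (0 <= F k A i z)%R by rewrite /F; case: ifP.
have mF k A i : measurable (A i) -> measurable_fun [set: Z] (F k A i).
  by move=> mA; rewrite /F; case: (i < k)%N => //; exact: measurable_indic.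
(* After [k] exchanges the factors of index below [k] are [h i] and the others are indicators of
   [A i]. The statement ranges over all [A], so that the next exchange can put an arbitrary set [B]
   at index [k]. *)
suff H k : (k <= n)%N -> forall A, (forall i, measurable (A i)) ->
    \int[P]_om (\prod_i F k A i (Zs i om))%:E = (\prod_i e k A i)%:E.
  have -> : (\prod_i c i)%R = (\prod_i e n (fun=> setT) i)%R.
    by apply: eq_bigr => i _; rewrite /e ltn_ord.
  rewrite -(H n (leqnn n) (fun=> setT) (fun=> measurableT)).
  apply: eq_integral => om _; congr EFin; apply: eq_bigr => i _.
  by rewrite /F ltn_ord.
elim: k => [_|k IH kn] A mA.
  transitivity (\int[P]_om (\1_(\bigcap_(i in [set: 'I_n]) (Zs i @^-1` A i)) om)%:E).
    apply: eq_integral => om _; congr EFin; rewrite /F /= indicE.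
    have [inA|ninA] := boolP (om \in _).
      rewrite big1// => i _; rewrite indicE mem_set//.
      by move: inA; rewrite inE => /(_ i); exact.
    move: ninA; rewrite notin_setE => /existsNP[i] /not_implyP[_ /= nAi].
    by rewrite (bigD1 i)//= indicE memNset// mul0r.
  have mZA i : measurable (Zs i @^-1` A i).
    by rewrite -[X in measurable X]setTI; exact: mZ.
  rewrite integral_indic// ?setIT; last by apply: fin_bigcap_measurable.
  apply: (etrans (Zind A mA)); rewrite -prodEFin; apply: eq_bigr => i _.
  by rewrite Zmu// /e /= fineK// fin_num_measure.
pose i0 := Ordinal kn.
have ltk i : i != i0 -> (i < k.+1)%N = (i < k)%N.
  by move=> /negbTE ii0; rewrite ltnS leq_eqVlt -[k]/(val i0) (inj_eq val_inj) ii0.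
pose Y om := (\prod_(i | i != i0) F k A i (Zs i om))%R.
pose y := (\prod_(i | i != i0) e k A i)%R.
have -> : (\prod_i e k.+1 A i)%:E = y%:E * \int[mu]_z (h i0 z)%:E.
  rewrite hc -EFinM mulrC (bigD1 i0)//= {1}/e ltnSn; congr (_ * _)%:E.
  by apply: eq_bigr => i ii0; rewrite /e ltk.
transitivity (\int[P]_om (Y om * h i0 (Zs i0 om))%:E).
  apply: eq_integral => om _; rewrite mulrC (bigD1 i0)//= {1}/F ltnSn.
  by congr (_ * _)%:E; apply: eq_bigr => i ii0; rewrite /F ltk.
apply: integral_mul_comp => //.
- rewrite /Y; under eq_fun do rewrite -big_filter.
  apply: measurable_prod => i _; apply: measurableT_comp => //; exact: mF.
- by move=> om; apply: prodr_ge0 => i _; exact: F0.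
move=> B mB; pose A' i := if i == i0 then B else A i.
have mA' i : measurable (A' i) by rewrite /A'; case: ifP.
have A'ne i : i != i0 -> A' i = A i by rewrite /A' => /negbTE ->.
have A'i0 : A' i0 = B by rewrite /A' eqxx.
have := IH (ltnW kn) A' mA'.
rewrite (bigD1 i0)//= {1}/e ltnn A'i0 mulrC EFinM fineK ?fin_num_measure//.
rewrite (eq_bigr (e k A)) => [|i ii0]; last by rewrite /e A'ne.
move=> <-; apply: eq_integral => om _; rewrite [in RHS](bigD1 i0)//= {1}/F ltnn A'i0.
rewrite mulrC; congr (_ * _)%:E; apply: eq_bigr => i ii0.
by rewrite /F A'ne.
Qed.

(** A product of [n] copies of Hoeffding's lemma at parameter [t / n]: this is how the exponent
    gains its factor [1 / n]. *)
Lemma mgf_iid_mean (f : Z -> R) (a fbar t : R) : (0 < n)%N ->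
  measurable_fun [set: Z] f ->
  (0 < a)%R -> (forall z, `|f z| <= a)%R -> (0 <= t)%R ->
  \int[mu]_z (f z)%:E = fbar%:E ->
  \int[P]_om (expR (t * (n%:R^-1 * \sum_i (fbar - f (Zs i om)))))%:E
    <= (expR (t ^+ 2 * a ^+ 2 / (2 * n%:R)))%:E.
Proof.
move=> n0 mf a0 fa t0 If.
have n0R : (0 < n%:R :> R)%R by rewrite ltr0n.
pose h z := expR (t / n%:R * (fbar - f z)).
have H : \int[mu]_z (h z)%:E <= (expR ((t / n%:R) ^+ 2 * a ^+ 2 / 2))%:E.
  by apply: hoeffding_lemma => //; rewrite divr_ge0.
have I0 : 0 <= \int[mu]_z (h z)%:E.
  by apply: integral_ge0 => z _; rewrite lee_fin expR_ge0.
pose c := fine (\int[mu]_z (h z)%:E).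
have cE : \int[mu]_z (h z)%:E = c%:E.
  by rewrite fineK// ge0_fin_numE// (le_lt_trans H)// ltry.
have -> : \int[P]_om (expR (t * (n%:R^-1 * \sum_i (fbar - f (Zs i om)))))%:E
    = \int[P]_om (\prod_i h (Zs i om))%:E.
  apply: eq_integral => om _; rewrite /h -expR_sum -mulr_sumr.
  by rewrite mulrA.
rewrite (@integral_prod_iid (fun=> h) (fun=> c))//; last first.
- by move=> i z; exact: expR_ge0.
- move=> i; apply: measurableT_comp => //; apply: measurable_funM => //.
  exact: measurable_funB.
rewrite prodr_const card_ord lee_fin.
have cle : (c <= expR ((t / n%:R) ^+ 2 * a ^+ 2 / 2))%R by rewrite -lee_fin -cE.
have c0 : (0 <= c)%R by rewrite -lee_fin -cE.
apply: (@le_trans _ _ (expR ((t / n%:R) ^+ 2 * a ^+ 2 / 2) ^+ n)%R).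
  by apply: lerXn2r => //; rewrite nnegrE ?expR_ge0.
rewrite -expRM_natr ler_expR le_eqVlt; apply/orP; left; apply/eqP.
by field; rewrite gt_eqF.
Qed.

End IndependentSample.

(** * The chaining argument, abstracted from networks *)

Section ChainedRiskBound.
Set Implicit Arguments.
Unset Strict Implicit.
Local Open Scope ereal_scope.
Context {R : realType} {dO : measure_display} {Omega : measurableType dO}.
Variables (P : probability Omega R) (d : nat) (T : choiceType).
Variables (U : 'I_d -> choiceType) (pre : forall k, T -> U k).
Variables (W : set T) (A : forall k, set (U k)).
Arguments A : clear implicits.
Hypothesis cW : countable W.
Hypothesis cA : forall k, countable (A k).
Hypothesis preW : forall k w, W w -> A k (pre k w).
Variables (p : Omega -> T -> R) (q : forall k, U k -> R).
Arguments q : clear implicits.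
Hypothesis pW : forall om, is_pmf W (p om).
Hypothesis mp : forall w, measurable_fun [set: Omega] (p ^~ w).
Hypothesis qA : forall k, is_pmf (A k) (q k).

(** Agrees with [marg] by conversion once [pre k] is a prefix map. *)
Let margp k om (v : U k) : R :=
  fine (\esum_(w in [set w | W w /\ pre k w = v]) (p om w)%:E).

Let margpA k om : is_pmf (A k) (@margp k om).
Proof. by have [_] := pmf_map (@preW k) (pW om). Qed.

Lemma measurable_margp k v : measurable_fun [set: Omega] (fun om => @margp k om v).
Proof.
apply: (measurableT_comp (fine_measurable measurableT)).
apply: emeasurable_esum.
- by apply: (sub_countable _ cW); apply: subset_card_le => w [].
- by move=> w _; exact/measurable_EFinP.
- by move=> w _ om; rewrite lee_fin; case: (pW om).
Qed.

Variables (m : T -> R) (S : T -> Omega -> R) (m0 : R) (S0 : Omega -> R).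
Variables (G : forall k, U k -> Omega -> R) (a t B : 'I_d -> R).
Hypothesis m_ge0 : forall w, W w -> (0 <= m w)%R.
Hypothesis S_ge0 : forall w, W w -> forall om, (0 <= S w om)%R.
Hypothesis mS : forall w, W w -> measurable_fun [set: Omega] (S w).
Hypothesis m0_ge0 : (0 <= m0)%R.
Hypothesis S0_ge0 : forall om, (0 <= S0 om)%R.
Hypothesis mS0 : measurable_fun [set: Omega] S0.
Hypothesis intS0 : \int[P]_om (S0 om)%:E = m0%:E.
Hypothesis mG : forall k v, A k v -> measurable_fun [set: Omega] (@G k v).
Hypothesis G_le : forall k v, A k v -> forall om, (`|@G k v om| <= a k)%R.
Hypothesis a_ge0 : forall k, (0 <= a k)%R.
Hypothesis t_gt0 : forall k, (0 < t k)%R.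
Hypothesis B_ge0 : forall k, (0 <= B k)%R.
Hypothesis mgf : forall k v, A k v ->
  \int[P]_om (expR (t k * @G k v om))%:E <= (expR (B k))%:E.
Hypothesis telescope : forall w om, W w ->
  (m w + S0 om = S w om + m0 + \sum_k G (pre k w) om)%R.

(** Here [m] and [S] stand for population and empirical risks, [m0] and [S0] for those of the
    reference network. [S0] need not be bounded, but its integral [m0] is finite and cancels after
    integration. *)
Lemma chained_risk_bound :
  \int[P]_om (\esum_(w in W) (p om w * m w)%:E) <=
  \int[P]_om (\esum_(w in W) (p om w * S w om)%:E) +
  \sum_k ((t k)^-1)%:E * (\int[P]_om KL (@margp k om) (q k) + (B k)%:E).
Proof.
have p0 om w : (0 <= p om w)%R by case: (pW om).
have Ga k v om : A k v -> (0 <= @G k v om + a k)%R.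
  by move=> /G_le/(_ om); rewrite ler_norml => /andP[]; lra.
have sa0 : (0 <= \sum_k a k)%R by exact: sumr_ge0.
pose E1 om := \esum_(w in W) (p om w * m w)%:E.
pose E2 om := \esum_(w in W) (p om w * S w om)%:E.
pose V k om := \esum_(v in A k) (@margp k om v * (@G k v om + a k))%:E.
have E1_ge0 om : 0 <= E1 om.
  by apply: esum_ge0 => w Ww; rewrite lee_fin mulr_ge0 ?m_ge0.
have E2_ge0 om : 0 <= E2 om.
  by apply: esum_ge0 => w Ww; rewrite lee_fin mulr_ge0 ?S_ge0.
have V_ge0 k om : 0 <= V k om.
  apply: esum_ge0 => v Av; rewrite lee_fin mulr_ge0 ?Ga//.
  by case: (@margpA k om).
have mE1 : measurable_fun [set: Omega] E1.
  apply: emeasurable_esum => // w Ww.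
    by apply/measurable_EFinP; exact: measurable_funM.
  by move=> om; rewrite lee_fin mulr_ge0 ?m_ge0.
have mE2 : measurable_fun [set: Omega] E2.
  apply: emeasurable_esum => // w Ww.
    by apply/measurable_EFinP; apply: measurable_funM => //; exact: mS.
  by move=> om; rewrite lee_fin mulr_ge0 ?S_ge0.
have mV k : measurable_fun [set: Omega] (V k).
  apply: emeasurable_esum => // v Av.
    apply/measurable_EFinP; apply: measurable_funM.
      exact: measurable_margp.
    by apply: measurable_funD => //; exact: mG.
  by move=> om; rewrite lee_fin mulr_ge0 ?Ga//; case: (@margpA k om).
(* The identity [telescope] averaged under [p om], with [a k] added to make each [G] nonnegative. As
   [G] sees [w] only through [pre k w], its average is one under [margp]. *)
have pw om : E1 om + (S0 om + \sum_k a k)%:E = E2 om + m0%:E + \sum_k V k om.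
  transitivity (\esum_(w in W) (p om w * (m w + S0 om + \sum_k a k))%:E).
    rewrite -(pmf_countable_esumr cW (pW om)) ?addr_ge0// -esumD.
    - by apply: eq_esum => w _; rewrite -EFinD; congr EFin; ring.
    - by move=> w Ww; rewrite lee_fin mulr_ge0 ?m_ge0.
    - by move=> w _; rewrite lee_fin mulr_ge0// addr_ge0.
  transitivity (\esum_(w in W) ((p om w * S w om)%:E + (p om w * m0)%:E
      + \sum_k (p om w * (G (pre k w) om + a k))%:E)).
    apply: eq_esum => w Ww; rewrite telescope// sumEFin -!EFinD; congr EFin.
    by rewrite -mulr_sumr big_split/=; ring.
  have pGa w k : W w -> 0 <= (p om w * (G (pre k w) om + a k))%:E.
    by move=> Ww; rewrite lee_fin mulr_ge0// Ga//; exact: preW.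
  rewrite esumD => [|w Ww|w Ww]; last 2 first.
  - by rewrite adde_ge0// lee_fin mulr_ge0// ?S_ge0.
  - by apply: sume_ge0 => k _; exact: pGa.
  rewrite esumD => [|w Ww|w Ww]; last 2 first.
  - by rewrite lee_fin mulr_ge0// ?S_ge0.
  - by rewrite lee_fin mulr_ge0.
  rewrite (pmf_countable_esumr cW (pW om))//; congr (_ + _).
  rewrite esum_sum => [|w k Ww _]; last exact: pGa.
  apply: eq_bigr => k _.
  rewrite -(@esum_pmf_map R T (U k) W (A k) (pre k) (p om) (fun v => G v om + a k)%R)//.
  - exact: preW.
  - by move=> v Av; exact: Ga.
have I1 (r : R) : \int[P]_om r%:E = r%:E.
  by rewrite integral_cst//= probability_setT mule1.
have : \int[P]_om (E1 om + (S0 om + \sum_k a k)%:E) =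
       \int[P]_om (E2 om + m0%:E + \sum_k V k om).
  by apply: eq_integral => om _; exact: pw.
have mSa : measurable_fun [set: Omega] (fun om => (S0 om + \sum_k a k)%:E).
  by apply/measurable_EFinP; exact: measurable_funD.
rewrite ge0_integralD//; last by move=> om _; rewrite lee_fin addr_ge0.
have -> : \int[P]_om (S0 om + \sum_k a k)%:E = (m0 + \sum_k a k)%:E.
  under eq_integral do rewrite EFinD.
  rewrite ge0_integralD//.
  - by rewrite intS0 I1 EFinD.
  - by move=> om _; rewrite lee_fin.
  - exact/measurable_EFinP.
rewrite ge0_integralD//; last 4 first.
- by move=> om _; rewrite adde_ge0// lee_fin.
- exact: emeasurable_funD.
- by move=> om _; apply: sume_ge0 => k _; exact: V_ge0.
- exact: emeasurable_sum.
rewrite ge0_integralD// I1 ge0_integral_sum// => H.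
have HV k : \int[P]_om V k om <=
    ((t k)^-1)%:E * (\int[P]_om KL (@margp k om) (q k) + (B k)%:E) + (a k)%:E.
  have := integral_le_KL (P := P) (cA k) (@margpA k) (@measurable_margp k) (qA k)
    (@mG k) (@G_le k) (t_gt0 k) (B_ge0 k) (a_ge0 k) (@mgf k).
  have ti0 : (0 <= (t k)^-1)%R by rewrite invr_ge0 ltW.
  have K0 : 0 <= \int[P]_om KL (@margp k om) (q k).
    by apply: integral_ge0 => om _; exact: (KL_ge0 (@margpA k) (qA k)).
  have ti0' : 0 <= ((t k)^-1)%:E by rewrite lee_fin.
  move=> /(lee_wpmul2l ti0').
  rewrite muleA -EFinM mulVf ?gt_eqF// mul1e => /le_trans; apply.
  rewrite EFinD addeA ge0_muleDr//; last 2 first.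
  - by rewrite adde_ge0// lee_fin.
  - by rewrite lee_fin mulr_ge0// ltW.
  by rewrite -EFinM mulrA mulVf ?gt_eqF// mul1r.
rewrite -(@leeD2rE _ (m0 + \sum_k a k)%:E)//.
apply: (@le_trans _ _ (\int[P]_om E2 om + m0%:E + \sum_k \int[P]_om V k om)).
  by rewrite -H.
apply: (@le_trans _ _ (\int[P]_om E2 om + m0%:E + \sum_k
    (((t k)^-1)%:E * (\int[P]_om KL (@margp k om) (q k) + (B k)%:E) + (a k)%:E))).
  by apply: leeD2l; apply: lee_sum => k _; exact: HV.
by rewrite big_split/= sumEFin EFinD addeACA.
Qed.

End ChainedRiskBound.

(** * Dirac masses and their relative entropy *)

Section Dirac.
Set Implicit Arguments.
Unset Strict Implicit.
Local Open Scope ereal_scope.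
Context {R : realType} {T : choiceType}.

Lemma esum_support1 (A : set T) (v : T) (f : T -> \bar R) : A v -> 0 <= f v ->
  (forall t, t != v -> f t = 0) -> \esum_(t in A) f t = f v.
Proof.
move=> Av fv0 f0; rewrite -[RHS](@esum_set1 _ _ v f)//.
rewrite [LHS]esum_mkcond [RHS]esum_mkcond; apply: eq_esum => t _.
have [->|tv] := eqVneq t v; first by rewrite !ifT// inE.
by rewrite f0//; case: ifP; case: ifP.
Qed.

Definition dirac_pmf (v t : T) : R := (t == v)%:R.

Lemma is_pmf_dirac (A : set T) (v : T) : A v -> is_pmf A (dirac_pmf v).
Proof.
move=> Av; split=> [t|t nAt|]; rewrite /dirac_pmf.
- exact: ler0n.
- by case: eqP => // tv; exfalso; apply: nAt; rewrite tv.
- by rewrite (esum_support1 Av) ?eqxx// => t /negbTE ->.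
Qed.

Lemma pmf_le1 (A : set T) (q : T -> R) v : is_pmf A q -> (q v <= 1)%R.
Proof.
move=> [q0 qA q1]; have [Av|/qA ->] := pselect (A v); last exact: ler01.
rewrite -lee_fin -q1 -(@esum_set1 _ _ v (fun t => (q t)%:E)) ?lee_fin//.
rewrite [leLHS]esum_mkcond [leRHS]esum_mkcond; apply: le_esum => t _.
case: ifPn => [|_]; last by case: ifP; rewrite lee_fin.
by rewrite inE => ->; rewrite ifT// inE.
Qed.

Lemma log_inv_ge0 (x : R) : (0 <= x <= 1)%R -> 0 <= log_inv x.
Proof.
move=> /andP[x0 x1]; rewrite /log_inv; case: eqVneq => // xn0.
by rewrite lee_fin ln_ge0// invf_ge1// lt0r xn0.
Qed.

(** The single surviving term is nonnegative because [q v <= 1], so the subtracted series vanishes,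
    even when [q v = 0]. *)
Lemma KL_dirac (A : set T) (q : T -> R) v : is_pmf A q ->
  KL (dirac_pmf v) q = log_inv (q v).
Proof.
move=> qA; have [q0 _ _] := qA.
have klv : kl_term (dirac_pmf v) q v = log_inv (q v).
  rewrite /kl_term /log_inv /dirac_pmf eqxx oner_eq0.
  by case: eqP => // _; rewrite mul1r div1r.
have kl0 t : t != v -> kl_term (dirac_pmf v) q t = 0.
  by move=> /negbTE tv; rewrite /kl_term /dirac_pmf tv eqxx.
have l0 : 0 <= log_inv (q v) by rewrite log_inv_ge0// q0 (pmf_le1 _ qA).
rewrite /KL (@esum_support1 setT v)//; last 2 first.
- by rewrite le_max lexx orbT.
- by move=> t tv; rewrite kl0// maxxx.
rewrite (@esum_support1 setT v)//; last 2 first.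
- by rewrite le_max lexx orbT.
- by move=> t tv; rewrite kl0// oppe0 maxxx.
by rewrite klv max_l// max_r ?oppe_le0// sube0.
Qed.

End Dirac.

(** * Prefixes of weight tuples *)

Section Prefixes.
Set Implicit Arguments.
Unset Strict Implicit.
Context {R : realType} {delta : nat -> nat}.

(** Coding each layer by an integer maps a tuple injectively to a finite function into [nat], which
    [pickle] numbers. *)
Lemma countable_inPref k (Wk : forall i, set (layerT R delta i)) :
  (forall i, (i < k)%N -> countable (Wk i)) ->
  countable (inPref Wk : set (prefT R delta k)).
Proof.
move=> cW.
have code i : exists f : layerT R delta i -> nat,
    (i < k)%N -> {in Wk i &, injective f}.
  have [ik|] := boolP (i < k)%N; last by exists (fun=> 0%N).
  by have /countable_injP[f finj] := cW i ik; exists f.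
pose f i := projT1 (cid (code i)).
have finj i (ik : (i < k)%N) : {in Wk i &, injective (f i)}.
  exact: (projT2 (cid (code i))).
apply/countable_injP.
exists (fun w : prefT R delta k => pickle [ffun i : 'I_k => f i (w i)]).
move=> w w' /[!inE] Ww Ww' /(pcan_inj pickleK)/ffunP ww'.
apply/ffunP => i; have := ww' i; rewrite !ffunE.
by apply: finj; rewrite ?inE.
Qed.

Lemma wprefix_inPref k d (hk : (k <= d)%N) (Wk : forall i, set (layerT R delta i))
    (w : prefT R delta d) : inPref Wk w -> inPref Wk (wprefix hk w).
Proof. by move=> Ww i; rewrite ffunE; exact: (Ww (widen_ord hk i)). Qed.

Lemma wget_wprefix k d (hk : (k <= d)%N) (w : prefT R delta d) i : (i < k)%N ->
  wget (wprefix hk w) i = wget w i.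
Proof.
move=> ik; have id := leq_trans ik hk.
rewrite !wgetE ffunE.
by rewrite /widen_ord (bool_irrelevance (widen_ord_proof (Ordinal ik) hk) id).
Qed.

Context {d : nat}.
Variable Mj : forall i : nat, layerT R delta i.

Lemma mixw_wprefix j k (hk : (k <= d)%N) (w : prefT R delta d) : (j <= k)%N ->
  mixw Mj j (wprefix hk w) = mixw Mj j w :> prefT R delta d.
Proof.
move=> jk; apply/ffunP => i; rewrite !ffunE; case: ifP => // ij.
by rewrite wget_wprefix// (leq_trans ij).
Qed.

Lemma mixw_all (w : prefT R delta d) : mixw Mj d w = w.
Proof.
by apply/ffunP => -[i id]; rewrite ffunE/= id wgetE.
Qed.

Lemma mixw_none k k' (w : prefT R delta k) (w' : prefT R delta k') :
  mixw Mj 0 w = mixw Mj 0 w' :> prefT R delta d.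
Proof. by apply/ffunP => i; rewrite !ffunE. Qed.

End Prefixes.

(** * The risk bound for an arbitrary conditional distribution *)

Section GeneralizationBound.
Set Implicit Arguments.
Unset Strict Implicit.
Context {R : realType} {d : nat} {delta : nat -> nat}.
Variables (Rx L : R) (Mj : forall i : nat, layerT R delta i) (alpha : nat -> R).
Variables (phi : forall k, 'cV[R]_k -> 'cV[R]_k) (soft : bool).
Arguments phi : clear implicits.
Context {dZ dO : measure_display} {Z : measurableType dZ} {Omega : measurableType dO}.
Variables (xof : Z -> 'cV[R]_(delta 0%N)) (mu : probability Z R).
Variables (loss : prefT R delta d -> Z -> R) (n : nat).
Variables (P : probability Omega R) (Zs : 'I_n -> Omega -> Z).
Variables (Wk : forall i : nat, set (layerT R delta i)).
Arguments Wk : clear implicits.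
Variables (Q : forall k : nat, prefT R delta k.+1 -> R) (gamma : nat -> R).
Arguments Q : clear implicits.
Hypothesis Rx0 : 0 < Rx.
Hypothesis L0 : 0 < L.
Hypothesis Ma0 : forall i, (i < d)%N -> 0 < specnorm (Mj i) /\ 0 < alpha i.
Hypothesis phi_lip : forall k (u v : 'cV[R]_k), norm2 (phi k u - phi k v) <= norm2 (u - v).
Hypothesis phi0 : forall k, phi k 0 = 0.
Hypothesis xof_le : forall z, norm2 (xof z) <= Rx.
Hypothesis loss_ge0 : forall w, inPref (Bset Mj alpha) w -> forall z, 0 <= loss w z.
Hypothesis mloss :
  forall w, inPref (Bset Mj alpha) w -> measurable_fun [set: Z] (loss w).
Hypothesis loss_lip :
  forall w w', inPref (Bset Mj alpha) w -> inPref (Bset Mj alpha) w' ->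
  forall z, `|loss w z - loss w' z|
    <= L * norm2 (net phi soft w (xof z) - net phi soft w' (xof z)).
Hypothesis n_gt0 : (0 < n)%N.
Hypothesis iid : iid_sample P mu Zs.
Hypothesis WB : forall i, (i < d)%N -> countable (Wk i) /\ Wk i `<=` Bset Mj alpha i.
Hypothesis QA : forall k, (k < d)%N -> is_pmf (inPref Wk) (Q k).
Hypothesis gamma0 : forall k, (k < d)%N -> 0 < gamma k.

Let C := L * Mprod Mj d * Rx * Num.sqrt 2.
Let c := C / Num.sqrt n%:R.
Let a (k : nat) := L * (Mprod Mj d * beta alpha k * Rx).
Local Notation BB := (inPref (Bset Mj alpha)).
Local Notation W := (inPref Wk).

Lemma Mprod_gt0 : 0 < Mprod Mj d.
Proof. by apply: prodr_gt0 => i _; have [] := Ma0 (ltn_ord i). Qed.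

Lemma beta_gt0 k : (k < d)%N -> 0 < beta alpha k.
Proof. by move=> kd; rewrite mulr_gt0 ?expR_gt0//; have [] := Ma0 kd. Qed.

Lemma layer_bound_gt0 k : (k < d)%N -> 0 < a k.
Proof.
move=> kd; apply: mulr_gt0 => //; apply: mulr_gt0 => //.
by apply: mulr_gt0; [exact: Mprod_gt0|exact: beta_gt0].
Qed.

Lemma rate_gt0 : 0 < c.
Proof.
apply: divr_gt0; last by rewrite sqrtr_gt0 ltr0n.
by rewrite /C !mulr_gt0 ?sqrtr_gt0 ?Mprod_gt0.
Qed.

Lemma inPref_WB k (w : prefT R delta k) : (k <= d)%N -> W w -> BB w.
Proof.
by move=> kd Ww i; have [_] := WB (leq_trans (ltn_ord i) kd); apply; exact: Ww.
Qed.

Let alpha_gt0 i : (i < d)%N -> 0 < alpha i.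
Proof. by move=> /Ma0[]. Qed.

Lemma mixw_BB j k (w : prefT R delta k) : (j <= k)%N -> (k <= d)%N -> BB w ->
  BB (mixw Mj j w : prefT R delta d).
Proof. exact: (mixw_Bset alpha_gt0). Qed.

Lemma loss_mixw_le k (w : prefT R delta k.+1) z : (k < d)%N -> BB w ->
  `|loss (mixw Mj k.+1 w) z - loss (mixw Mj k w) z| <= a k.
Proof.
move=> kd Bw.
apply: (le_trans (loss_lip (mixw_BB (leqnn _) kd Bw) (mixw_BB (leqnSn k) kd Bw) z)).
by rewrite /a ler_wpM2l ?(ltW L0)// (net_mixw_le alpha_gt0 phi_lip phi0).
Qed.

(** Serves the finiteness of risks: every loss lies within one constant of that of the reference
    network, uniformly in the data point. *)
Lemma loss_center_le (w : prefT R delta d) z : BB w ->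
  `|loss w z - loss (mixw Mj 0 w) z| <= \sum_(k < d) a k.
Proof.
move=> Bw.
have -> : loss w z - loss (mixw Mj 0 w) z =
    \sum_(k < d) (loss (mixw Mj k.+1 w) z - loss (mixw Mj k w) z).
  rewrite -(big_mkord xpredT (fun k => loss (mixw Mj k.+1 w) z - loss (mixw Mj k w) z)).
  by rewrite (telescope_sumr (fun k => loss (mixw Mj k w) z))// mixw_all.
rewrite (le_trans (ler_norm_sum _ _ _))//; apply: ler_sum => k _.
rewrite -(mixw_wprefix Mj (ltn_ord k))// -(@mixw_wprefix _ _ _ _ k _ (ltn_ord k))//.
by apply: loss_mixw_le => //; exact: wprefix_inPref.
Qed.

Local Open Scope ereal_scope.

Lemma integral_sample (g : Z -> R) i : measurable_fun [set: Z] g ->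
  (forall z, (0 <= g z)%R) -> \int[P]_om (g (Zs i om))%:E = \int[mu]_z (g z)%:E.
Proof.
move=> mg g0; have [mZ Zmu _] := iid; rewrite -[RHS]mul1e.
rewrite -(@integral_mul_comp R _ _ _ _ P mu (Zs i) (cst 1%R) 1%R g)//.
  by apply: eq_integral => om _; rewrite mul1r.
move=> A mA; rewrite mul1e -(Zmu i)//.
have mZA : measurable (Zs i @^-1` A) by rewrite -[X in measurable X]setTI; exact: mZ.
transitivity (\int[P]_om (\1_(Zs i @^-1` A) om)%:E).
  by apply: eq_integral => om _; rewrite mul1r.
by rewrite integral_indic// setIT.
Qed.

Lemma measurable_sample : measurable_fun [set: Omega] (sample Zs).
Proof.
have [mZ _ _] := iid; apply/measurable_fun_tnthP => i.
rewrite (_ : _ \o _ = Zs i)//; apply/funext => om /=.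
by rewrite tnth_mktuple.
Qed.

Lemma LS_sample w om : LS loss (sample Zs om) w = (n%:R^-1 * \sum_(i < n) loss w (Zs i om))%R.
Proof. by rewrite /LS; congr (_ * _)%R; apply: eq_bigr => i _; rewrite tnth_mktuple. Qed.

Lemma measurable_LS w : BB w -> measurable_fun [set: Omega] (fun om => LS loss (sample Zs om) w).
Proof.
move=> Bw; have [mZ _ _] := iid; under eq_fun do rewrite LS_sample.
apply: measurable_funM => //; apply: measurable_sum => i.
by apply: measurableT_comp => //; exact: mloss.
Qed.

Lemma LS_ge0 w om : BB w -> (0 <= LS loss (sample Zs om) w)%R.
Proof.
move=> Bw; rewrite LS_sample mulr_ge0 ?invr_ge0//.
by apply: sumr_ge0 => i _; exact: loss_ge0.
Qed.

Lemma Lmu_ge0 w : BB w -> 0 <= Lmu mu loss w.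
Proof. by move=> Bw; apply: integral_ge0 => z _; rewrite lee_fin loss_ge0. Qed.

Lemma integral_LS w : BB w ->
  \int[P]_om (LS loss (sample Zs om) w)%:E = Lmu mu loss w.
Proof.
move=> Bw; have [mZ _ _] := iid.
have mlZ i : measurable_fun [set: Omega] (fun om => (loss w (Zs i om))%:E).
  by apply/measurable_EFinP; apply: measurableT_comp => //; exact: mloss.
under eq_integral do rewrite LS_sample EFinM -sumEFin.
rewrite ge0_integralZl_EFin ?invr_ge0//; last 2 first.
- by move=> om _; apply: sume_ge0 => i _; rewrite lee_fin loss_ge0.
- exact: emeasurable_sum.
rewrite ge0_integral_sum//; last by move=> i om _; rewrite lee_fin loss_ge0.
rewrite (eq_bigr (fun=> 1%:E * Lmu mu loss w)) => [|i _]; last first.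
  by rewrite mul1e; apply: integral_sample; [exact: mloss|exact: loss_ge0].
rewrite -ge0_sume_distrl// sumEFin sumr_const card_ord muleA -EFinM mulVf ?mul1e//.
by rewrite pnatr_eq0 -lt0n.
Qed.

Lemma exp_emp_risk_dirac w : W w ->
  exp_emp_risk P Zs W loss (fun=> dirac_pmf w) = Lmu mu loss w.
Proof.
move=> Ww; have Bw := inPref_WB (leqnn d) Ww.
rewrite -integral_LS//; apply: eq_integral => om _.
rewrite (esum_support1 Ww) /dirac_pmf ?eqxx ?mul1e ?lee_fin ?LS_ge0//.
by move=> t /negbTE ->; rewrite mul0e.
Qed.

Lemma marg_dirac k (hk : (k <= d)%N) w : W w ->
  marg hk W (dirac_pmf w) = dirac_pmf (wprefix hk w) :> (_ -> R).
Proof.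
move=> Ww; apply/funext => v; rewrite /marg [in RHS]/dirac_pmf eq_sym.
have [wv|wv] := eqVneq (wprefix hk w) v.
  rewrite (@esum_support1 _ _ _ w)//= /dirac_pmf ?eqxx ?lee_fin//.
  by move=> t /negbTE ->.
rewrite esum1// => t [Wt tv]; rewrite /dirac_pmf; case: eqP => // tw.
by rewrite -tv tw eqxx in wv.
Qed.

Lemma cond_KL_dirac k (kd : (k < d)%N) w : W w ->
  cond_KL P Zs (fun=> marg kd W (dirac_pmf w)) (Q k) = log_inv (Q k (wprefix kd w)).
Proof.
move=> Ww; rewrite /cond_KL marg_dirac// (KL_dirac _ (QA kd)).
have [q0 _ _] := QA kd; have := pmf_le1 (wprefix kd w) (QA kd).
rewrite integral_cst//= probability_setT mule1//.
Qed.

Variable w0 : prefT R delta d.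
Hypothesis Bw0 : BB w0.
Hypothesis Lw0 : Lmu mu loss w0 < +oo.

(** Finiteness at [w0] spreads to all of [BB]: both losses are compared with the reference network,
    which is the same for [w] and [w0], hence the factor 2. *)
Lemma Lmu_fin w : BB w -> Lmu mu loss w \is a fin_num.
Proof.
move=> Bw; rewrite ge0_fin_numE ?Lmu_ge0//.
apply: (@le_lt_trans _ _ (Lmu mu loss w0 + ((\sum_(k < d) a k) *+ 2)%:E)); last first.
  by rewrite lte_add_pinfty// ltry.
have I1 (r : R) : \int[mu]_z r%:E = r%:E.
  by rewrite integral_cst//= probability_setT mule1.
have sa0 : (0 <= (\sum_(k < d) a k) *+ 2)%R.
  by rewrite mulrn_wge0// sumr_ge0// => k _; rewrite ltW// layer_bound_gt0.
have ml0 : measurable_fun [set: Z] (fun z => (loss w0 z)%:E).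
  by apply/measurable_EFinP; exact: mloss.
rewrite -(I1 (_ *+ 2)%R) /Lmu -ge0_integralD//; last first.
  by move=> z _; rewrite lee_fin loss_ge0.
apply: ge0_le_integral => //.
- by move=> z _; rewrite lee_fin loss_ge0.
- by apply/measurable_EFinP; exact: mloss.
- exact: emeasurable_funD.
move=> z _; rewrite -EFinD lee_fin.
have := loss_center_le z Bw; have := loss_center_le z Bw0.
by rewrite (mixw_none Mj w0 w) !ler_norml mulr2n => /andP[h1 h2] /andP[h3 h4]; lra.
Qed.

Lemma integrable_loss w : BB w -> mu.-integrable [set: Z] (EFin \o loss w).
Proof.
move=> Bw; apply/integrableP; split; first by apply/measurable_EFinP; exact: mloss.
have := Lmu_fin Bw; rewrite ge0_fin_numE ?Lmu_ge0//; congr (_ < _).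
by apply: eq_integral => z _; rewrite /= ger0_norm// loss_ge0.
Qed.

Let m w := fine (Lmu mu loss w).
Let gen w om : R := (m w - LS loss (sample Zs om) w)%R.

Lemma integral_loss_diff w w' : BB w -> BB w' ->
  \int[mu]_z (loss w z - loss w' z)%:E = (m w - m w')%:E.
Proof.
move=> Bw Bw'; under eq_integral do rewrite EFinB.
rewrite integralB_EFin ?EFinB /m ?fineK ?Lmu_fin//; exact: integrable_loss.
Qed.

Lemma mgf_gen_mixw k (v : prefT R delta k.+1) (t : R) : (k < d)%N -> BB v -> (0 <= t)%R ->
  \int[P]_om (expR (t * (gen (mixw Mj k.+1 v) om - gen (mixw Mj k v) om)))%:E
    <= (expR (t ^+ 2 * a k ^+ 2 / (2 * n%:R)))%:E.
Proof.
move=> kd Bv t0.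
have B1 : BB (mixw Mj k.+1 v : prefT R delta d) by exact: mixw_BB.
have B0 : BB (mixw Mj k v : prefT R delta d) by exact: mixw_BB.
pose f z := (loss (mixw Mj k.+1 v) z - loss (mixw Mj k v) z)%R.
pose fbar := (m (mixw Mj k.+1 v) - m (mixw Mj k v))%R.
have nn0 : n%:R != 0%R :> R by rewrite pnatr_eq0 -lt0n.
have If : \int[mu]_z (f z)%:E = fbar%:E by exact: integral_loss_diff.
have -> : \int[P]_om (expR (t * (gen (mixw Mj k.+1 v) om - gen (mixw Mj k v) om)))%:E
    = \int[P]_om (expR (t * (n%:R^-1 * \sum_i (fbar - f (Zs i om)))))%:E.
  apply: eq_integral => om _; congr ((expR (t * _))%:E).
  rewrite /gen !LS_sample sumrB [X in (_ * (_ - X))%R]sumrB sumr_const card_ord.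
  by rewrite -[(fbar *+ n)%R]mulr_natl /fbar; field.
apply: (mgf_iid_mean iid) => //.
- by apply: measurable_funB; exact: mloss.
- exact: layer_bound_gt0.
- by move=> z; exact: loss_mixw_le.
Qed.

Lemma generalization_bound (K : n.-tuple Z -> prefT R delta d -> R) :
  is_cond_dist W K ->
  risk P Zs W mu loss K <= exp_emp_risk P Zs W loss K +
    \sum_(k < d) ((c * (beta alpha k * gamma k))%:E *
        cond_KL P Zs (fun s => marg (ltn_ord k) W (K s)) (Q k)
      + (c * (beta alpha k / (4 * gamma k)))%:E).
Proof.
move=> [KW mK].
have cW k : (k <= d)%N -> countable (inPref Wk : set (prefT R delta k)).
  by move=> kd; apply: countable_inPref => i ik; have [] := WB (leq_trans ik kd).
have s2 : (Num.sqrt 2 ^+ 2 = 2 :> R)%R by rewrite sqr_sqrtr.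
have sn : (Num.sqrt n%:R ^+ 2 = n%:R :> R)%R by rewrite sqr_sqrtr.
have sn0 : (0 < Num.sqrt n%:R :> R)%R by rewrite sqrtr_gt0 ltr0n.
pose t (k : 'I_d) := ((c * (beta alpha k * gamma k))^-1)%R.
have t0 k : (0 < t k)%R.
  rewrite invr_gt0; apply: mulr_gt0; first exact: rate_gt0.
  by apply: mulr_gt0; [exact: beta_gt0|exact: gamma0].
pose G (k : 'I_d) (v : prefT R delta k.+1) om : R :=
  (gen (mixw Mj k.+1 v) om - gen (mixw Mj k v) om)%R.
have mgen w : BB w -> measurable_fun [set: Omega] (gen w).
  by move=> Bw; apply: measurable_funB => //; exact: measurable_LS.
have lossd (k : 'I_d) (v : prefT R delta k.+1) z : W v ->
    (`|loss (mixw Mj k.+1 v) z - loss (mixw Mj k v) z| <= a k)%R.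
  by move=> Wv; apply: loss_mixw_le => //; exact: inPref_WB.
have mBB (k : 'I_d) (v : prefT R delta k.+1) j : (j <= k.+1)%N -> W v ->
    BB (mixw Mj j v : prefT R delta d).
  by move=> jk Wv; apply: mixw_BB => //; exact: inPref_WB.
have Bc : BB (mixw Mj 0 w0 : prefT R delta d) by exact: mixw_BB.
have m_ge0 w : BB w -> (0 <= m w)%R by move=> Bw; apply/fine_ge0/Lmu_ge0.
(* This crude bound, with its factor 2, only supplies the shift that makes [G] nonnegative and
   cancels later; the exponent in [mgf] keeps the sharp [a k]. *)
have G_le (k : 'I_d) (v : prefT R delta k.+1) : W v ->
    forall om, (`|G k v om| <= a k *+ 2)%R.
  move=> Wv om; have Bv := inPref_WB (ltn_ord k) Wv.
  have -> : G k v om = ((m (mixw Mj k.+1 v) - m (mixw Mj k v)) -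
      (LS loss (sample Zs om) (mixw Mj k.+1 v) - LS loss (sample Zs om) (mixw Mj k v)))%R.
    by rewrite /G /gen; ring.
  rewrite mulr2n (le_trans (ler_normB _ _))// lerD//; last first.
    rewrite !LS_sample -mulrBr -sumrB normrM ger0_norm ?invr_ge0//.
    rewrite ler_pdivrMl ?ltr0n// (le_trans (ler_norm_sum _ _ _))//.
    have -> : (n%:R * a k = \sum_(i < n) a k)%R by rewrite sumr_const card_ord mulr_natl.
    by apply: ler_sum => i _; exact: lossd.
  apply: (norm_integral_le (mu := mu) (f := fun z =>
    (loss (mixw Mj k.+1 v) z - loss (mixw Mj k v) z)%R)).
  - by apply: measurable_funB; apply: mloss; exact: mBB.
  - by move=> z; exact: lossd.
  - by apply: integral_loss_diff; exact: mBB.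
have H := @chained_risk_bound R _ Omega P d _ (fun k => prefT R delta k.+1)
  (fun k => wprefix (ltn_ord k)) W (fun k => W) (cW d (leqnn d)) (fun k => cW _ (ltn_ord k))
  (fun k w => @wprefix_inPref _ _ _ _ (ltn_ord k) Wk w)
  (fun om => K (sample Zs om)) (fun k => Q k) (fun om => KW _)
  (fun w => measurableT_comp (mK w) measurable_sample) (fun k => QA (ltn_ord k))
  m (fun w om => LS loss (sample Zs om) w) (m (mixw Mj 0 w0))
  (fun om => LS loss (sample Zs om) (mixw Mj 0 w0))
  G (fun k => (a k *+ 2)%R) t (fun k => (t k ^+ 2 * a k ^+ 2 / (2 * n%:R))%R).
have WBB w : W w -> BB w := @inPref_WB d w (leqnn d).
have Ec : \int[P]_om (LS loss (sample Zs om) (mixw Mj 0 w0))%:E = (m (mixw Mj 0 w0))%:E.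
  by rewrite integral_LS// fineK// Lmu_fin.
have mG (k : 'I_d) (v : prefT R delta k.+1) : W v -> measurable_fun [set: Omega] (G k v).
  by move=> Wv; apply: measurable_funB; apply: mgen; exact: mBB.
have a2_ge0 (k : 'I_d) : (0 <= a k *+ 2)%R by rewrite mulrn_wge0// ltW// layer_bound_gt0.
have B_ge0 (k : 'I_d) : (0 <= t k ^+ 2 * a k ^+ 2 / (2 * n%:R))%R.
  by rewrite divr_ge0// mulr_ge0 ?sqr_ge0.
have mgf (k : 'I_d) (v : prefT R delta k.+1) : W v ->
    \int[P]_om (expR (t k * G k v om))%:E <= (expR (t k ^+ 2 * a k ^+ 2 / (2 * n%:R)))%:E.
  by move=> Wv; apply: mgf_gen_mixw => //; [exact: inPref_WB|exact: ltW].
have tele w om : W w -> (m w + LS loss (sample Zs om) (mixw Mj 0 w0) =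
    LS loss (sample Zs om) w + m (mixw Mj 0 w0) +
    \sum_k G k (wprefix (ltn_ord k) w) om)%R.
  move=> Ww; pose u k := gen (mixw Mj k w) om.
  rewrite (eq_bigr (fun k : 'I_d => u k.+1 - u k)%R) => [|k _]; last first.
    by rewrite /G /u !mixw_wprefix.
  rewrite -(big_mkord xpredT (fun k => u k.+1 - u k)%R) telescope_sumr// /u mixw_all.
  by rewrite (mixw_none Mj w w0) /gen; ring.
have {}H := H (fun w Ww => m_ge0 w (WBB w Ww)) (fun w Ww om => LS_ge0 om (WBB w Ww))
  (fun w Ww => measurable_LS (WBB w Ww)) (m_ge0 _ Bc) (fun om => LS_ge0 om Bc)
  (measurable_LS Bc) Ec mG G_le a2_ge0 t0 B_ge0 mgf tele.
rewrite [leLHS](_ : _ = \int[P]_om \esum_(w in W) (K (sample Zs om) w * m w)%:E); last first.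
  apply: eq_integral => om _; apply: eq_esum => w Ww.
  by rewrite EFinM fineK//; exact/Lmu_fin/WBB.
apply: (le_trans H); rewrite le_eqVlt; apply/orP; left; apply/eqP; congr (_ + _).
apply: eq_bigr => k _.
have margA om := (pmf_map (@wprefix_inPref _ _ _ _ (ltn_ord k) Wk) (KW (sample Zs om))).2.
rewrite ge0_muleDr; last 2 first.
- by apply: integral_ge0 => om _; exact: (KL_ge0 margA (QA (ltn_ord k))).
- by rewrite lee_fin B_ge0.
rewrite /t invrK.
congr (_ + _); rewrite -EFinM; congr EFin.
have bk := beta_gt0 (ltn_ord k); have gk := gamma0 (ltn_ord k).
have C0 : (0 < C)%R by rewrite /C !mulr_gt0 ?sqrtr_gt0 ?Mprod_gt0.
have -> : (a k ^+ 2 = C ^+ 2 * beta alpha k ^+ 2 / 2)%R.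
  by rewrite /a /C !exprMn s2; field.
rewrite -[in LHS]sn /c; field.
by rewrite !gt_eqF.
Qed.

End GeneralizationBound.

Theorem theorem2 (R : realType)
  (* architecture: depth d, widths delta_0 = m, delta_1, ..., delta_d *)
  (d : nat) (delta : nat -> nat)
  (* radius R of the input ball, Lipschitz constant L of the loss *)
  (Rx L : R)
  (* reference matrices M_j and radii alpha_j (0-based index i = j - 1) *)
  (Mj : forall i : nat, layerT R delta i) (alpha : nat -> R)
  (* activation phi and output activation phi_o (soft = true: soft-max) *)
  (phi : forall k, 'cV[R]_k -> 'cV[R]_k) (soft : bool)
  (* data space Z, with input map Z -> X, and data distribution mu *)
  (dZ : measure_display) (Z : measurableType dZ)
  (xof : Z -> 'cV[R]_(delta 0%N)) (mu : probability Z R)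
  (* loss *)
  (loss : prefT R delta d -> Z -> R)
  (* the i.i.d. sample S = (Z_1, ..., Z_n) on a probability space *)
  (n : nat) (dO : measure_display) (Omega : measurableType dO)
  (P : probability Omega R) (Zs : 'I_n -> Omega -> Z)
  (* countable index sets W_k, priors Q^(k), temperatures gamma_k *)
  (Wk : forall i : nat, set (layerT R delta i))
  (Q : forall k : nat, prefT R delta k.+1 -> R) (gamma : nat -> R)
  (* the minimizing algorithm and the population minimizer w_hat *)
  (Kstar : n.-tuple Z -> prefT R delta d -> R) (what : prefT R delta d) :
  (2 <= d)%N ->
  (forall j, (j <= d)%N -> (0 < delta j)%N) ->
  0 < Rx -> 0 < L ->
  (forall i, (i < d)%N -> 0 < specnorm (Mj i) /\ 0 < alpha i) ->
  (* phi is 1-Lipschitz for the Euclidean norm and phi(0) = 0 *)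
  (forall k (u v : 'cV[R]_k), norm2 (phi k u - phi k v) <= norm2 (u - v)) ->
  (forall k, phi k 0 = 0) ->
  (* inputs lie in the ball of radius R *)
  (forall z, norm2 (xof z) <= Rx) ->
  (* the loss: nonnegative, measurable, L-Lipschitz in h_w(x) on B_1 x ... x B_d *)
  (forall w, inPref (Bset Mj alpha) w -> forall z, 0 <= loss w z) ->
  (forall w, inPref (Bset Mj alpha) w -> measurable_fun [set: Z] (loss w)) ->
  (forall w w', inPref (Bset Mj alpha) w -> inPref (Bset Mj alpha) w' ->
     forall z, `|loss w z - loss w' z|
               <= L * norm2 (net phi soft w (xof z) - net phi soft w' (xof z))) ->
  (0 < n)%N ->
  iid_sample P mu Zs ->
  (* W_k countable subset of B_k *)
  (forall i, (i < d)%N -> countable (Wk i) /\ Wk i `<=` Bset Mj alpha i) ->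
  (* Q^(k) probability distribution on W_1 x ... x W_k *)
  (forall k, (k < d)%N -> is_pmf (inPref Wk) (Q k)) ->
  (forall k, (k < d)%N -> 0 < gamma k) ->
  (* Kstar attains the minimum of the regularized objective *)
  let C := L * Mprod Mj d * Rx * Num.sqrt 2 in
  let objective (K : n.-tuple Z -> prefT R delta d -> R) : \bar R :=
    (exp_emp_risk P Zs (inPref Wk) loss K
     + (C / Num.sqrt n%:R)%:E *
       \sum_(k < d) ((beta alpha k * gamma k)%:E *
          cond_KL P Zs (fun s => marg (ltn_ord k) (inPref Wk) (K s)) (Q k)))%E in
  is_cond_dist (inPref Wk) Kstar ->
  (forall K, is_cond_dist (inPref Wk) K -> (objective Kstar <= objective K)%E) ->
  (* w_hat minimizes L_mu over W *)
  inPref Wk what ->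
  (forall w, inPref Wk w -> (Lmu mu loss what <= Lmu mu loss w)%E) ->
  (risk P Zs (inPref Wk) mu loss Kstar
   <= ereal_inf [set Lmu mu loss w | w in inPref Wk]
      + (C / Num.sqrt n%:R)%:E *
        \sum_(k < d) ((beta alpha k)%:E *
          ((gamma k)%:E * log_inv (Q k (wprefix (ltn_ord k) what))
           + ((4 * gamma k)^-1)%:E)))%E.
Proof.
move=> d2 delta_gt0 Rx0 L0 Ma0 phi_lip phi0 xof_le loss_ge0 mloss loss_lip n_gt0 iid
  WB QA gamma0 C objective Kc Kmin Wwhat what_min.
set c := C / Num.sqrt n%:R.
have c0 : 0 < c by exact: (rate_gt0 Rx0 L0 Ma0 n_gt0).
have BWw : inPref (Bset Mj alpha) what by exact: (inPref_WB WB (leqnn d) Wwhat).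
have b0 (k : 'I_d) : 0 < beta alpha k by exact: (beta_gt0 Ma0 (ltn_ord k)).
have g0 (k : 'I_d) : 0 < gamma k by exact: gamma0.
have y0 (k : 'I_d) : (0 <= log_inv (Q k (wprefix (ltn_ord k) what)))%E.
  have [q0 _ _] := QA k (ltn_ord k).
  by rewrite log_inv_ge0// q0 (pmf_le1 _ (QA k (ltn_ord k))).
have split_sum (z : 'I_d -> \bar R) : (forall k, (0 <= z k)%E) ->
    (\sum_(k < d) ((c * (beta alpha k * gamma k))%:E * z k
        + (c * (beta alpha k / (4 * gamma k)))%:E)
    = c%:E * \sum_(k < d) ((beta alpha k * gamma k)%:E * z k)
        + \sum_(k < d) (c * (beta alpha k / (4 * gamma k)))%:E)%E.
  move=> z0; rewrite big_split/= ge0_sume_distrr => [|k _]; last first.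
    by rewrite mule_ge0// lee_fin mulr_ge0// ltW.
  by congr (_ + _)%E; apply: eq_bigr => k _; rewrite muleA -EFinM.
have y_sum : (c%:E * \sum_(k < d) ((beta alpha k)%:E *
          ((gamma k)%:E * log_inv (Q k (wprefix (ltn_ord k) what))
           + ((4 * gamma k)^-1)%:E)) =
    \sum_(k < d) ((c * (beta alpha k * gamma k))%:E *
        log_inv (Q k (wprefix (ltn_ord k) what))
        + (c * (beta alpha k / (4 * gamma k)))%:E))%E.
  have gy k : (0 <= (gamma (nat_of_ord k))%:E * log_inv (Q k (wprefix (ltn_ord k) what)))%E.
    by rewrite mule_ge0// lee_fin ltW.
  have gi (k : 'I_d) : (0 <= ((4 * gamma k)^-1)%:E)%E.
    by rewrite lee_fin invr_ge0 mulr_ge0// ltW.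
  rewrite ge0_sume_distrr => [|k _]; last first.
    by rewrite mule_ge0 ?adde_ge0// lee_fin ltW.
  apply: eq_bigr => k _.
  have b0' : (0 <= (beta alpha k)%:E)%E by rewrite lee_fin ltW.
  have bgy := mule_ge0 b0' (gy k); have bgi := mule_ge0 b0' (gi k).
  rewrite !ge0_muleDr//.
  by rewrite !muleA -!EFinM !mulrA.
set I := ereal_inf [set Lmu mu loss w | w in inPref Wk].
have LI : (Lmu mu loss what <= I)%E.
  by apply: le_ereal_inf_tmp => _ [w Ww <-]; exact: what_min.
(* If the risk of [what] is infinite, so is the infimum, and the bound is trivial because the other
   summand is nonnegative, hence not [-oo]. Otherwise [what] serves as the [w0] of
   [generalization_bound]. *)
have [Lfin|] := ltP (Lmu mu loss what) +oo%E; last first.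
  move=> /le_trans/(_ LI); rewrite leye_eq => /eqP ->.
  rewrite addye ?leey// gt_eqF// (@lt_le_trans _ _ 0%E)// y_sum.
  apply: sume_ge0 => k _; have bk := b0 k; have gk := g0 k.
  rewrite adde_ge0// ?mule_ge0// lee_fin ltW// mulr_gt0//; first exact: mulr_gt0.
  by rewrite divr_gt0// mulr_gt0.
have x0 (k : 'I_d) :
    (0 <= cond_KL P Zs (fun s => marg (ltn_ord k) (inPref Wk) (Kstar s)) (Q k))%E.
  have [KW _] := Kc.
  have margA om :=
    (pmf_map (@wprefix_inPref _ _ _ _ (ltn_ord k) Wk) (KW (sample Zs om))).2.
  by apply: integral_ge0 => om _; exact: (KL_ge0 margA (QA k (ltn_ord k))).
have := generalization_bound Rx0 L0 Ma0 phi_lip phi0 xof_le loss_ge0 mloss loss_lip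
  n_gt0 iid WB QA gamma0 BWw Lfin Kc.
rewrite -/C -/c => /le_trans; apply.
(* The terms with [gamma k] in the denominator are common to both sides and cancel; what remains on
   the left is the objective at [Kstar]. *)
rewrite split_sum// addeA y_sum split_sum// addeA leeD2r//.
have dc : is_cond_dist (inPref Wk) (fun _ : n.-tuple Z => dirac_pmf (R := R) what).
  by split=> // s; exact: is_pmf_dirac.
apply: (le_trans (Kmin _ dc)); rewrite /objective -/c.
rewrite (exp_emp_risk_dirac loss_ge0 mloss n_gt0 iid WB Wwhat).
apply: leeD => //.
rewrite lee_wpmul2l ?lee_fin ?(ltW c0)//; apply: lee_sum => k _.
by rewrite (cond_KL_dirac _ _ QA).
Qed.
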